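(* Let $p$ be a prime, $h\geq 2$, $g\in\mathbb{S}_h$, and let $t_i=t_i(g)\in R$ be the associated elements. Modulo $(p,u_1,\dots,u_{h-2},u_{h-1}^{p^{h-1}+1})$, $$t_{h-1} = t_{h-1}^{p^{h}} + u_{h-1} t_h^{p^{h-1}} - \sum_{j=1}^{p-1}\frac{1}{p}\binom{p}{j}u_{h-1}^{jp^{h-2}+1}t_1^{jp^{2h-3}}t_0^{p^{2h-2}(p-j)}.$$
   Context: Let $\mathbb{W}=W(\mathbb{F}_{p^h})$ be the Witt vectors and $R=\mathbb{W}[[u_1,\dots,u_{h-1}]]$ with maximal ideal $(p,u_1,\dots,u_{h-1})$. (For $h=2$ the ideal $(p,u_1,\dots,u_{h-2})$ is $(p)$.) Let $\mathbb{H}$ be the Honda formal group law of height $h$: the unique $p$-typical formal group law over $\mathbb{F}_p$ with $p$-series $[p]_{\mathbb{H}}(x)=x^{p^h}$, regarded over $\mathbb{F}_{p^h}$. Universal deformation: let $V=\mathbb{Z}_{(p)}[v_1,v_2,\dots]$ be the ring representing $p$-typical formal group laws over $\mathbb{Z}_{(p)}$-algebras, with universal $p$-typical formal group law $G$ of logarithm $\sum_{i\ge0}l_ix^{p^i}$, $l_0=1$, where the $v_i$ are the Araki generators: $v_0=p$ and $p\,l_n=\sum_{0\le i\le n}l_iv_{n-i}^{p^i}$. Let $\phi:V\to R$ send $v_i\mapsto u_i$ for $1\le i\le h-1$, $v_h\mapsto1$, $v_i\mapsto0$ for $i>h$, and set $F=\phi_*G$. $F$ is a universal deformation of $\mathbb{H}$: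 a deformation of $\mathbb{H}$ to a complete local ring $A$ with maximal ideal $\mathfrak m$ is a formal group law over $A$ together with an inclusion $i:\mathbb{F}_{p^h}\to A/\mathfrak m$ such that the reduction of the formal group law mod $\mathfrak m$ is $i_*\mathbb{H}$; a $\star$-isomorphism is an isomorphism of formal group laws $f$ with $f(x)\equiv x$ mod $\mathfrak m$; and for each deformation $(H,i)$ to $A$ there are a unique continuous $\mathbb{W}$-algebra map $\iota:R\to A$ and a unique $\star$-isomorphism $\iota_*F\to H$. $\mathbb{S}_h$ is the automorphism group of $\mathbb{H}$ over $\mathbb{F}_{p^h}$, identified with the unit group of $\mathbb{W}\langle S\rangle/(S^h=p,\ Sa=a^\sigma S)$ ($a\in\mathbb{W}$, $\sigma$ the lift of Frobenius); its elements are written $g=\sum_{i\ge0}g_iS^i$ with $g_i\in\mathbb{W}$, $g_i^{p^h}=g_i$. Action: lift $g\in\mathbb{S}_h$ to $\hat g(x)\in\mathbb{W}[[x]]$ and set $\hat F(x,y)=\hat g^{-1}(F(\hat g(x),\hat g(y)))$. Then $(\hat F,\mathrm{id})$ is a deformation of $\mathbb{H}$ to $R$, so it determines a unique homomorphism $g_*:R\to R$ and a unique $\star$-isomorphism $g_*F\to\hat F$. The composite $h_g:g_*F\to\hat F\xrightarrow{\hat g}F$ is independent of the choice of $\hat g$ and can be written uniquely as a formal sum $h_g(x)=\sum^F_{i\ge0}t_i(g)x^{p^i}$ with $t_i=t_i(g)\in R$; $t_i\equiv g_i$ modulo $(p,u_1,\dots,u_{h-1})$ and $t_0$ is a unit.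 *)

(* Defs.v *)
From HB Require Import structures.
From mathcomp Require Import all_boot all_order all_algebra.
From mathcomp Require Import boolp finmap.
From mathcomp Require Import ring.
From mathcomp Require Import monalg.
From mathcomp Require Import mpoly.

Set Implicit Arguments.
Unset Strict Implicit.
Unset Printing Implicit Defensive.

Import Order.TTheory GRing.Theory Num.Theory.

Local Open Scope ring_scope.

Record mseries (n : nat) (A : Type) := MSeries { scoef :> 'X_{1..n} -> A }.

HB.instance Definition _ n A := [isNew for @scoef n A].
HB.instance Definition _ n (A : eqType) := [Equality of mseries n A by <:].
HB.instance Definition _ n (A : choiceType) := [Choice of mseries n A by <:].

Lemma seriesP n A (f g : mseries n A) : (forall m, f m = g m) -> f = g.
Proof. by case: f g => [f] [g] /= fg; congr MSeries; apply: funext. Qed.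

Definition smap n A B (f : A -> B) (s : mseries n A) : mseries n B :=
  MSeries (fun m => f (s m)).

Section SeriesRing.
Context (n : nat) (A : comNzRingType).
Implicit Types (f g : mseries n A) (m : 'X_{1..n}).

Definition sconst (c : A) : mseries n A := MSeries (fun m => c *+ (m == 0%MM)).
Definition svar (i : 'I_n) : mseries n A := MSeries (fun m => (m == U_(i)%MM)%:R).

Definition sadd f g : mseries n A := MSeries (fun m => f m + g m).
Definition sopp f : mseries n A := MSeries (fun m => - f m).
Definition smul f g : mseries n A := MSeries (fun m =>
  \sum_(k : 'X_{1..n < (mdeg m).+1, (mdeg m).+1} | m == (k.1 + k.2)%MM)
     f k.1 * g k.2).

Fact saddA : associative sadd.
Proof. by move=> f g l; apply: seriesP => m /=; rewrite addrA. Qed.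
Fact saddC : commutative sadd.
Proof. by move=> f g; apply: seriesP => m /=; rewrite addrC. Qed.
Fact sadd0 : left_id (sconst 0) sadd.
Proof. by move=> f; apply: seriesP => m /=; rewrite mul0rn add0r. Qed.
Fact saddN : left_inverse (sconst 0) sopp sadd.
Proof. by move=> f; apply: seriesP => m /=; rewrite mul0rn addNr. Qed.

HB.instance Definition _ := GRing.isZmodule.Build (mseries n A)
  saddA saddC sadd0 saddN.

Definition strunc d f : mpoly n A :=
  \sum_(m : 'X_{1..n < d}) f m *: 'X_[m].

Lemma mcoeff_strunc d f m : (mdeg m < d)%N -> (strunc d f)@_m = f m.
Proof.
move=> lt_md; rewrite /strunc raddf_sum /= (bigD1 (BMultinom lt_md)) //=.
rewrite mcoeffZ mcoeffX eqxx mulr1 big1 ?addr0 // => i ne_im.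
rewrite mcoeffZ mcoeffX; case: eqP => [eq_im|_]; last by rewrite mulr0.
by case/eqP: ne_im; apply: val_inj.
Qed.

Lemma smulE d (P Q : mpoly n A) f g m : (mdeg m < d)%N ->
  (forall k, (mdeg k < d)%N -> P@_k = f k) ->
  (forall k, (mdeg k < d)%N -> Q@_k = g k) ->
  smul f g m = (P * Q)@_m.
Proof.
move=> lt_md Pf Qg; rewrite mcoeffM /=; apply: eq_bigr => -[i j] /= _.
by rewrite Pf ?Qg //; apply: leq_trans (bmdeg _) lt_md.
Qed.

Fact smulA : associative smul.
Proof.
move=> f g l; apply: seriesP => m; pose d := (mdeg m).+1.
rewrite (@smulE d (strunc d f) (strunc d g * strunc d l)) //; first last.
- move=> k lt_kd; symmetry; apply: smulE (lt_kd) _ _ => *; exact: mcoeff_strunc.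
- by move=> k; apply: mcoeff_strunc.
rewrite (@smulE d (strunc d f * strunc d g) (strunc d l)) ?mulrA //; first last.
- by move=> k; apply: mcoeff_strunc.
- move=> k lt_kd; symmetry; apply: smulE (lt_kd) _ _ => *; exact: mcoeff_strunc.
Qed.

Fact smulC : commutative smul.
Proof.
move=> f g; apply: seriesP => m; pose d := (mdeg m).+1.
have H s k : (mdeg k < d)%N -> (strunc d s)@_k = s k by apply: mcoeff_strunc.
by rewrite !(smulE (ltnSn _) (H _) (H _)) mulrC.
Qed.

Fact smul1 : left_id (sconst 1) smul.
Proof.
move=> f; apply: seriesP => m; pose d := (mdeg m).+1.
rewrite (@smulE d 1 (strunc d f)) ?mul1r ?mcoeff_strunc // => k lt_kd.
  by rewrite mcoeff1.
exact: mcoeff_strunc.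
Qed.

Fact smulDl : left_distributive smul sadd.
Proof.
move=> f g l; apply: seriesP => m /=; rewrite -big_split /=.
by apply: eq_bigr => i _; rewrite mulrDl.
Qed.

Fact sone_neq0 : sconst 1 != 0.
Proof.
by apply/eqP => /(congr1 (fun s : mseries n A => s 0%MM))/eqP;
  rewrite /= eqxx oner_eq0.
Qed.

HB.instance Definition _ := GRing.Zmodule_isComNzRing.Build (mseries n A)
  smulA smulC smul1 smulDl sone_neq0.

End SeriesRing.

Arguments svar {n A} i.
Arguments sconst {n A} c.

(* Substitution f(g_0, ..., g_{n-1}), meaningful when every g_i has zero      *)
(* constant term: monomials of f of degree > mdeg k then contribute nothing   *)
(* to the coefficient of k, so the sum below is the full one.                 *)
Definition scomp n q (A : comNzRingType) (f : mseries n A)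
    (g : 'I_n -> mseries q A) : mseries q A :=
  MSeries (fun k => \sum_(e : 'X_{1..n < (mdeg k).+1})
                       f e * (\prod_(i < n) g i ^+ e i) k).

Definition scomp1 q (A : comNzRingType) (f : mseries 1 A) (a : mseries q A) :=
  scomp f (fun _ => a).
Definition scomp2 q (A : comNzRingType) (F : mseries 2 A) (a b : mseries q A) :=
  scomp F (fun i => if i == ord0 then a else b).

Notation sx := (svar (ord0 : 'I_1)).
Notation sx2 := (svar (ord0 : 'I_2)).
Notation sy2 := (svar (ord_max : 'I_2)).

Section FormalGroups.
Context (A : comNzRingType).
Implicit Types (F : mseries 2 A) (f : mseries 1 A).

Definition is_fgl F : Prop :=
  [/\ scomp2 F sx 0 = sx, scomp2 F 0 sx = sx, scomp2 F sy2 sx2 = F &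
      let x := svar (inord 0 : 'I_3) in
      let y := svar (inord 1 : 'I_3) in
      let z := svar (inord 2 : 'I_3) in
      scomp2 F (scomp2 F x y) z = scomp2 F x (scomp2 F y z)].

Definition fgl_hom F F' f : Prop :=
  f 0%MM = 0 /\ scomp1 f F = scomp2 F' (scomp1 f sx2) (scomp1 f sy2).

Definition comp_inverse f f' : Prop :=
  [/\ f' 0%MM = 0, scomp1 f f' = sx & scomp1 f' f = sx].

Definition fgl_iso F F' f : Prop :=
  fgl_hom F F' f /\ exists f', comp_inverse f f'.

(* [n]_F(x) *)
Definition fgl_nseries F (n : nat) : mseries 1 A :=
  iter n (fun s => scomp2 F s sx) 0.

Fixpoint fgl_psum F (c : nat -> mseries 1 A) (n : nat) : mseries 1 A :=
  if n is n'.+1 then scomp2 F (fgl_psum F c n') (c n') else 0.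

(* s is the infinite formal sum \sum^F_i c_i, i.e. the coefficientwise limit  *)
(* of the partial formal sums.                                                *)
Definition is_fgl_sum F (c : nat -> mseries 1 A) (s : mseries 1 A) : Prop :=
  forall m, exists N, forall n, (N <= n)%N -> fgl_psum F c n m = s m.

End FormalGroups.

Definition in_ideal (A : comNzRingType) (I : finType) (s : I -> A) (x : A) :=
  exists c : I -> A, x = \sum_i c i * s i.

Definition in_ideal_pow (A : comNzRingType) (I : finType) (s : I -> A)
    (N : nat) (x : A) :=
  in_ideal (fun w : {ffun 'I_N -> I} => \prod_(j < N) s (w j)) x.

(* p-typical Witt vectors: the sum, product and opposite are given            *)
(* coordinatewise by the integral polynomials determined by the requirement   *)
(* that the ghost components                                                  *)
(*   w_n = \sum_(i <= n) p^i x_i^(p^(n-i))                                    *)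
(* be ring morphisms; their integrality is Dwork's lemma.                     *)
Definition ghost (p : nat) (B : comNzRingType) (x : nat -> B) (n : nat) : B :=
  \sum_(i < n.+1) (p ^ i)%:R * x i ^+ (p ^ (n - i)).

Notation zpoly I := {malg int[{cmonom I}]}.
Definition zvar (I : choiceType) (i : I) : zpoly I := << ucm i >>.

Section Evaluation.
Context (I : choiceType) (B : comNzRingType) (c : I -> B).

Definition mon_eval (m : {cmonom I}) : B := \prod_(i <- finsupp m) c i ^+ m i.

Lemma mon_evalEw (d : {fset I}) (m : {cmonom I}) : (finsupp m `<=` d)%fset ->
  mon_eval m = \prod_(i <- d) c i ^+ m i.
Proof.
move=> le; rewrite /mon_eval (big_fset_incl _ le) //= => i _.
by rewrite -cmE_eq0 => /eqP ->; rewrite expr0.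
Qed.

Fact mon_eval_morph : mmorphism mon_eval.
Proof.
split=> [m1 m2|]; last by rewrite /mon_eval mdom1 big_seq_fset0.
rewrite {1}/mon_eval mdomD.
rewrite (mon_evalEw (fsubsetUl _ (finsupp m2))).
rewrite (mon_evalEw (fsubsetUr (finsupp m1) _)).
by rewrite -big_split /=; apply: eq_bigr => i _; rewrite cmM exprD.
Qed.

HB.instance Definition _ := isMultiplicative.Build _ _ mon_eval mon_eval_morph.

Definition zeval : {rmorphism zpoly I -> B} :=
  monalg.mmap (intmul 1 : {rmorphism int -> B}) mon_eval.

Lemma zeval_var i : zeval (zvar i) = c i.
Proof.
by rewrite /zeval /= monalg.mmapU /= mul1r /mon_eval mdomU big_seq_fset1 cmUU expr1.
Qed.

End Evaluation.

Lemma zmonM (I : choiceType) (m1 m2 : {cmonom I}) :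
  mkmalgU (mmul m1 m2) 1 = mkmalgU m1 1 * mkmalgU m2 1 :> zpoly I.
Proof.
rewrite malgM_def.
rewrite fgmulUU.
by rewrite mulr1.
Qed.

Lemma zpoly_ind (I : choiceType) (P : zpoly I -> Prop) :
  P 1 -> (forall a b, P a -> P b -> P (a + b)) -> (forall a, P a -> P (- a)) ->
  (forall a b, P a -> P b -> P (a * b)) -> (forall i, P (zvar i)) ->
  forall a, P a.
Proof.
move=> P1 PD PN PM PX a.
have P0 : P 0 by rewrite -(subrr 1); apply: PD => //; apply: PN.
have PZ (z : int) : P z%:~R.
  have Pn n : P n%:R by elim: n => // n IH; rewrite -natr1; apply: PD.
  by case: z => n; [exact: Pn | rewrite NegzE mulrNz; apply: PN; exact: Pn].
have PU d (m : {cmonom I}) : (monalg.mdeg m < d)%N -> P (mkmalgU m 1).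
  elim: d m => [m lt_m0|d IHd m lt_md]; first by exfalso; rewrite ltn0 in lt_m0.
  have [m0|m_neq0] := eqVneq (monalg.mdeg m) 0%N.
    rewrite (mdeg_eq0I m0) [mkmalgU _ _]monalg.mpolyC1E; exact: P1.
  have [i mi_gt0] : exists i, (0 < m i)%N.
    have : finsupp m != fset0.
      by apply: contraNneq m_neq0 => m0; rewrite monalg.mdegE m0 big_seq_fset0.
    by case/fset0Pn => i; rewrite -cmE_neq0 -lt0n; exists i.
  pose q := divcm m (ucm i).
  have def_m : m = mmul (ucm i) q.
    apply/eqP/cmP => j; rewrite cmM cmU divcmE cmU.
    by case: (eqVneq i j) => [<-|_]; rewrite ?subn0 // subnKC.
  have -> : mkmalgU m 1 = zvar i * mkmalgU q 1.
    by rewrite {1}def_m zmonM.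
  apply: PM; [exact: PX | apply: IHd]; move: lt_md.
  by rewrite {1}def_m monalg.mdegM monalg.mdegU.
rewrite [a]monalgE; apply: big_ind; [exact: P0 | exact: PD | move=> m _].
have -> : mkmalgU m (monalg.mcoeff m a) = (monalg.mcoeff m a)%:~R * mkmalgU m 1.
  by rewrite mulrzl -raddfMz /= intz.
by apply: PM; [exact: PZ | exact: PU (ltnSn _)].
Qed.

Section Divides.
Context (B : comNzRingType).
Implicit Types (c x y : B).

Definition divides c x : Prop := exists r, x = c * r.

Lemma divides_mulr c x y : divides c x -> divides c (x * y).
Proof. by case=> r ->; exists (r * y); rewrite mulrA. Qed.

Lemma divides_add c x y : divides c x -> divides c y -> divides c (x + y).
Proof. by case=> r -> [s ->]; exists (r + s); rewrite mulrDr. Qed.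

Lemma divides_opp c x : divides c x -> divides c (- x).
Proof. by case=> r ->; exists (- r); rewrite mulrN. Qed.

Lemma divides_sum c n (F : 'I_n -> B) :
  (forall i, divides c (F i)) -> divides c (\sum_i F i).
Proof.
move=> dF; apply: big_ind => //; first by exists 0; rewrite mulr0.
exact: divides_add.
Qed.

Lemma divides_mul c d x y : divides c x -> divides d y -> divides (c * d) (x * y).
Proof. by case=> r -> [s ->]; exists (r * s); rewrite mulrACA. Qed.

Lemma divides_nat (a b : nat) : (a %| b)%N -> divides a%:R b%:R.
Proof. by case/dvdnP => q ->; exists q%:R; rewrite mulnC natrM. Qed.

Lemma divides_subM c x x' y y' :
  divides c (x - x') -> divides c (y - y') -> divides c (x * y - x' * y').
Proof.
move=> dx dy; have -> : x * y - x' * y' = (x - x') * y + (y - y') * x'.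
  by rewrite !mulrBl (mulrC y x') (mulrC y' x') addrA subrK.
by apply: divides_add; apply: divides_mulr.
Qed.

Section Prime.
Context (p : nat) (pr_p : prime p).

Lemma divides_exprD x y : divides p%:R ((x + y) ^+ p - (x ^+ p + y ^+ p)).
Proof.
have p_gt0 := prime_gt0 pr_p; rewrite exprDn -(prednK p_gt0).
rewrite big_ord_recl big_ord_recr /= /bump subn0 bin0 subnn binn.
rewrite !expr0 !mulr1 !mul1r !mulr1n addrCA addrK (prednK p_gt0).
refine (divides_sum _) => i /=; rewrite -[_ *+ 'C(_, _)]mulr_natl ?leq0n ?add1n.
apply: divides_mulr; apply: divides_nat; apply: prime_dvd_bin => //.
by rewrite -ltn_predRL ltn_ord.
Qed.

Lemma divides_exprB k x y : divides (p ^ k.+1)%:R (x - y) ->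
  divides (p ^ k.+2)%:R (x ^+ p - y ^+ p).
Proof.
move=> dxy; rewrite subrXX expnSr natrM; apply: divides_mul => //.
have dp : divides p%:R (x - y).
  by case: dxy => r ->; rewrite expnS natrM -mulrA; apply: divides_mulr; exists 1; rewrite mulr1.
have -> : \sum_(i < p) x ^+ (p.-1 - i) * y ^+ i =
    \sum_(i < p) (x ^+ (p.-1 - i) - y ^+ (p.-1 - i)) * y ^+ i + p%:R * y ^+ p.-1.
  rewrite mulr_natl -[X in _ *+ X]card_ord -sumr_const -big_split /=.
  apply: eq_bigr => i _; rewrite mulrBl -exprD subnK ?subrK //.
  by rewrite -ltnS (ltn_predK (ltn_ord i)).
apply: divides_add; last by exists (y ^+ p.-1).
refine (divides_sum _) => i /=; apply: divides_mulr; rewrite subrXX.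
exact: divides_mulr.
Qed.

Section FrobeniusLift.
Context (phi : {rmorphism B -> B}).

Let frob a := divides p%:R (a ^+ p - phi a).

Lemma frob1 : frob 1.
Proof. by exists 0; rewrite rmorph1 expr1n subrr mulr0. Qed.

Lemma frobD a b : frob a -> frob b -> frob (a + b).
Proof.
case=> r fa [s fb]; have [t /eqP] := divides_exprD a b.
rewrite subr_eq => /eqP E; exists (t + (r + s)).
by rewrite E !mulrDr -fa -fb rmorphD -addrA opprD (addrACA (a ^+ p)).
Qed.

Lemma frobN a : frob a -> frob (- a).
Proof.
case=> r fa; have [t] := divides_exprD a (- a).
rewrite subrr expr0n gtn_eqF ?prime_gt0 //= sub0r => /eqP.
rewrite eqr_oppLR => /eqP E; exists (- t - r); rewrite rmorphN.
by rewrite mulrBr mulrN -E -fa opprK opprB [RHS]addrC addrA subrK addrC.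
Qed.

Lemma frobM a b : frob a -> frob b -> frob (a * b).
Proof.
case=> r fa [s fb]; exists (r * b ^+ p + phi a * s).
by rewrite rmorphM exprMn mulrDr mulrA -fa mulrCA -fb mulrBl mulrBr addrA subrK.
Qed.

End FrobeniusLift.

Section Dwork.
Context (phi : {rmorphism B -> B}).
Hypothesis phi_frob : forall x, divides p%:R (x ^+ p - phi x).

Lemma divides_frobX j x :
  divides (p ^ j.+1)%:R (x ^+ (p ^ j.+1) - phi x ^+ (p ^ j)).
Proof.
elim: j => [|j IHj]; first by rewrite expn1 expn0 expr1.
have expS y k : y ^+ (p ^ k.+1) = (y ^+ (p ^ k)) ^+ p by rewrite -exprM -expnSr.
by rewrite (expS x j.+1) (expS (phi x) j); apply: divides_exprB.
Qed.

Definition dquo c x : B :=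
  if pselect (divides c x) is left dcx then projT1 (cid dcx) else 0.

Lemma dquoP c x : divides c x -> x = c * dquo c x.
Proof. by rewrite /dquo; case: pselect => // dcx _; case: (cid dcx). Qed.

Context (s : nat -> B).

Fixpoint dwork_seq (n : nat) : seq B :=
  if n is m.+1 then
    let l := dwork_seq m in
    rcons l (dquo (p ^ m)%:R
      (s m - \sum_(i < m) (p ^ i)%:R * l`_i ^+ (p ^ (m - i))))
  else [::].

Lemma size_dwork_seq n : size (dwork_seq n) = n.
Proof. by elim: n => //= n IHn; rewrite size_rcons IHn. Qed.

Definition dwork_coord n := (dwork_seq n.+1)`_n.

Lemma nth_dwork_seq n i : (i < n)%N -> (dwork_seq n)`_i = dwork_coord i.
Proof.
elim: n => // n IHn; rewrite ltnS leq_eqVlt => /predU1P[->|lt_in] //.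
by rewrite /= nth_rcons size_dwork_seq lt_in IHn.
Qed.

Hypothesis s_cong : forall n, divides (p ^ n.+1)%:R (s n.+1 - phi (s n)).

Lemma dworkP n : ghost p dwork_coord n = s n.
Proof.
have step m : divides (p ^ m)%:R
    (s m - \sum_(i < m) (p ^ i)%:R * dwork_coord i ^+ (p ^ (m - i))) ->
    ghost p dwork_coord m = s m.
  move=> dm; rewrite /ghost big_ord_recr /= subnn expn0 expr1.
  rewrite {2}/dwork_coord /= nth_rcons size_dwork_seq ltnn eqxx.
  under [in dquo _ _]eq_bigr => i _ do rewrite nth_dwork_seq //.
  by rewrite -dquoP // addrC subrK.
elim: n => [|n IHn]; apply: step.
  by rewrite big_ord0 subr0 expn0; exists (s 0%N); rewrite mul1r.
rewrite -(subrK (phi (s n)) (s n.+1)) -addrA; apply: divides_add => //.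
rewrite -IHn /ghost rmorph_sum -sumrB; refine (divides_sum _) => i /=.
have le_in : (i <= n)%N by rewrite -ltnS.
rewrite rmorphM rmorphXn rmorph_nat -mulrBr subSn //.
have -> : (p ^ n.+1)%:R = (p ^ i)%:R * (p ^ (n - i).+1)%:R :> B.
  by rewrite -natrM -expnD -subSn // subnKC // leqW.
apply: divides_mul; first by exists 1; rewrite mulr1.
by rewrite -opprB; apply: divides_opp; apply: divides_frobX.
Qed.

End Dwork.
End Prime.
End Divides.

Section Ghost.
Context (p : nat).

Lemma ghost_rmorph (B C : comNzRingType) (f : {rmorphism B -> C}) x n :
  f (ghost p x n) = ghost p (fun i => f (x i)) n.
Proof.
by rewrite rmorph_sum; apply: eq_bigr => i _; rewrite rmorphM rmorphXn rmorph_nat.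
Qed.

Lemma ghost_inj (B : comNzRingType) (x y : nat -> B) :
    (forall n (b : B), (p ^ n)%:R * b = 0 -> b = 0) ->
  (forall n, ghost p x n = ghost p y n) -> forall n, x n = y n.
Proof.
move=> tf eq_xy n; have [m] := ubnP n; elim: m n => // m IHm n lt_nm.
have := eq_xy n; rewrite /ghost !big_ord_recr /= subnn expn0 !expr1.
rewrite (eq_bigr (fun i : 'I_n => (p ^ i)%:R * y i ^+ (p ^ (n - i)))).
  by move/addrI/eqP; rewrite -subr_eq0 -mulrBr => /eqP/tf/eqP; rewrite subr_eq0 => /eqP.
by move=> i _; rewrite IHm //; apply: leq_trans (ltn_ord i) _.
Qed.

End Ghost.

Lemma zeval_comp (I : choiceType) (B C : comNzRingType) (f : {rmorphism B -> C})
  (c : I -> B) a : f (zeval c a) = zeval (fun i => f (c i)) a.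
Proof.
elim/zpoly_ind: a => [|a b IHa IHb|a IHa|a b IHa IHb|i].
- by rewrite !rmorph1.
- by rewrite !rmorphD IHa IHb.
- by rewrite !rmorphN IHa.
- by rewrite !rmorphM IHa IHb.
- by rewrite !zeval_var.
Qed.

Lemma zpoly_torsionfree (I : choiceType) (m : nat) (a : zpoly I) :
  (0 < m)%N -> m%:R * a = 0 -> a = 0.
Proof.
move=> m_gt0; rewrite mulr_natl => ma0; apply/malgP => k.
have := congr1 (monalg.mcoeff k) ma0; rewrite raddfMn raddf0 => /eqP.
by rewrite -mulr_natr mulf_eq0 pnatr_eq0 gtn_eqF // orbF => /eqP.
Qed.

Section WittPolynomials.
Context (p : nat) (pr_p : prime p).

(* the variable (j, i) is the i-th coordinate of the j-th argument *)
Local Notation ZX := (zpoly (nat * nat)%type).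

Definition zfrob : {rmorphism ZX -> ZX} := zeval (fun ji => zvar ji ^+ p).

Lemma zfrobP a : divides p%:R (a ^+ p - zfrob a).
Proof.
apply: (@zpoly_ind _ (fun a => divides p%:R (a ^+ p - zfrob a))) => {a}.
- exact: frob1.
- exact: frobD.
- exact: frobN.
- exact: frobM.
- by move=> i; exists 0; rewrite /zfrob zeval_var subrr mulr0.
Qed.

Definition zX (j i : nat) : ZX := zvar (j, i).

Lemma ghostX_cong j n : divides (p ^ n.+1)%:R
  (ghost p (zX j) n.+1 - zfrob (ghost p (zX j) n)).
Proof.
rewrite ghost_rmorph /ghost [X in X - _]big_ord_recr /= addrAC -sumrB big1.
  by rewrite add0r; apply: divides_mulr; exists 1; rewrite mulr1.
move=> i _; rewrite /zfrob zeval_var -exprM -expnS -subSn ?subrr //.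
by rewrite -ltnS ltn_ord.
Qed.

Definition addW_poly := dwork_coord p (fun n => ghost p (zX 0) n + ghost p (zX 1) n).
Definition mulW_poly := dwork_coord p (fun n => ghost p (zX 0) n * ghost p (zX 1) n).
Definition oppW_poly := dwork_coord p (fun n => - ghost p (zX 0) n).

Lemma addW_polyP n : ghost p addW_poly n = ghost p (zX 0) n + ghost p (zX 1) n.
Proof.
apply: (dworkP (phi := zfrob) zfrobP) => m.
by rewrite rmorphD opprD addrACA; apply: divides_add; apply: ghostX_cong.
Qed.

Lemma mulW_polyP n : ghost p mulW_poly n = ghost p (zX 0) n * ghost p (zX 1) n.
Proof.
apply: (dworkP (phi := zfrob) zfrobP) => m; rewrite rmorphM.
by apply: divides_subM; apply: ghostX_cong.
Qed.

Lemma oppW_polyP n : ghost p oppW_poly n = - ghost p (zX 0) n.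
Proof.
apply: (dworkP (phi := zfrob) zfrobP) => m.
by rewrite rmorphN -opprD; apply: divides_opp; apply: ghostX_cong.
Qed.

End WittPolynomials.

(* Witt vectors with coefficients in C; the primality proof is a parameter    *)
(* because the ring structure depends on it.                                  *)
Record witt (p : nat) (pr_p : prime p) (C : Type) := Witt { wcoord :> nat -> C }.

HB.instance Definition _ p (pr_p : prime p) C := [isNew for @wcoord p pr_p C].
HB.instance Definition _ p (pr_p : prime p) (C : eqType) :=
  [Equality of witt pr_p C by <:].
HB.instance Definition _ p (pr_p : prime p) (C : choiceType) :=
  [Choice of witt pr_p C by <:].

Section GhostLaws.
Context (T : Type) (R : comNzRingType) (w : T -> nat -> R).
Context (zero one : T) (add mul : T -> T -> T) (opp : T -> T).
Hypothesis w_inj : forall x y, (forall n, w x n = w y n) -> x = y.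
Hypothesis w0 : forall n, w zero n = 0.
Hypothesis w1 : forall n, w one n = 1.
Hypothesis wD : forall x y n, w (add x y) n = w x n + w y n.
Hypothesis wM : forall x y n, w (mul x y) n = w x n * w y n.
Hypothesis wN : forall x n, w (opp x) n = - w x n.

Lemma ghost_laws :
  [/\ associative add, commutative add, left_id zero add &
      left_inverse zero opp add] /\
  [/\ associative mul, commutative mul, left_id one mul &
      left_distributive mul add].
Proof.
split; split.
- by move=> x y z; apply: w_inj => n; rewrite !wD addrA.
- by move=> x y; apply: w_inj => n; rewrite !wD addrC.
- by move=> x; apply: w_inj => n; rewrite wD w0 add0r.
- by move=> x; apply: w_inj => n; rewrite wD wN addNr w0.
- by move=> x y z; apply: w_inj => n; rewrite !wM mulrA.
- by move=> x y; apply: w_inj => n; rewrite !wM mulrC.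
- by move=> x; apply: w_inj => n; rewrite wM w1 mul1r.
- by move=> x y z; apply: w_inj => n; rewrite wM !wD !wM mulrDl.
Qed.

End GhostLaws.

Section WittRing.
Context (p : nat) (pr_p : prime p).

Lemma wittP C (x y : witt pr_p C) : (forall n, x n = y n) -> x = y.
Proof. by case: x y => [x] [y] /= xy; congr Witt; apply: funext. Qed.

Section Operations.
Context (C : comNzRingType).
Implicit Types (x y z : witt pr_p C).

Definition wzero : witt pr_p C := Witt pr_p (fun _ => 0).
Definition wone : witt pr_p C := Witt pr_p (fun n => (n == 0%N)%:R).

Definition wargs (l : seq (witt pr_p C)) (ji : nat * nat) : C :=
  nth wzero l ji.1 ji.2.

Definition wadd x y := Witt pr_p (fun n => zeval (wargs [:: x; y]) (addW_poly p n)).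
Definition wmul x y := Witt pr_p (fun n => zeval (wargs [:: x; y]) (mulW_poly p n)).
Definition wopp x := Witt pr_p (fun n => zeval (wargs [:: x]) (oppW_poly p n)).

Lemma ghost_wzero n : ghost p wzero n = 0.
Proof.
rewrite /ghost big1 // => i _ /=.
by rewrite expr0n expn_eq0 -[p == 0%N]negbK -lt0n prime_gt0 // mulr0.
Qed.

Lemma ghost_wone n : ghost p wone n = 1.
Proof.
rewrite /ghost big_ord_recl /= expn0 mul1r expr1n big1 ?addr0 // => i _ /=.
by rewrite expr0n expn_eq0 -[p == 0%N]negbK -lt0n prime_gt0 // mulr0.
Qed.

Lemma ghost_zX l j n : zeval (wargs l) (ghost p (zX j) n) = ghost p (nth wzero l j) n.
Proof.
rewrite ghost_rmorph; congr ghost; apply: funext => i.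
by rewrite /zX zeval_var.
Qed.

Lemma ghost_wadd x y n : ghost p (wadd x y) n = ghost p x n + ghost p y n.
Proof.
have E := congr1 (zeval (wargs [:: x; y])) (addW_polyP pr_p n).
apply: etrans (etrans E _).
  exact: esym (ghost_rmorph p (zeval (wargs [:: x; y])) (addW_poly p) n).
rewrite rmorphD; congr (_ + _); [exact: (ghost_zX _ 0) | exact: (ghost_zX _ 1)].
Qed.

Lemma ghost_wmul x y n : ghost p (wmul x y) n = ghost p x n * ghost p y n.
Proof.
have E := congr1 (zeval (wargs [:: x; y])) (mulW_polyP pr_p n).
apply: etrans (etrans E _).
  exact: esym (ghost_rmorph p (zeval (wargs [:: x; y])) (mulW_poly p) n).
rewrite rmorphM; congr (_ * _); [exact: (ghost_zX _ 0) | exact: (ghost_zX _ 1)].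
Qed.

Lemma ghost_wopp x n : ghost p (wopp x) n = - ghost p x n.
Proof.
have E := congr1 (zeval (wargs [:: x])) (oppW_polyP pr_p n).
apply: etrans (etrans E _).
  exact: esym (ghost_rmorph p (zeval (wargs [:: x])) (oppW_poly p) n).
rewrite rmorphN; congr (- _); exact: (ghost_zX _ 0).
Qed.

End Operations.

Section Functoriality.
Context (B C : comNzRingType) (f : {rmorphism B -> C}).

Definition wmap (x : witt pr_p B) : witt pr_p C := Witt pr_p (fun n => f (x n)).

Lemma wmap_zero : wmap (wzero B) = wzero C.
Proof. by apply: wittP => n /=; rewrite rmorph0. Qed.

Lemma wmap_one : wmap (wone B) = wone C.
Proof. by apply: wittP => n /=; rewrite rmorph_nat. Qed.

Lemma wmap_args l : (fun ji => f (wargs l ji)) = wargs (map wmap l).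
Proof.
apply: funext => -[j i]; rewrite /wargs /=.
have [lt_jl|le_lj] := ltnP j (size l); first by rewrite (nth_map (wzero B)).
by rewrite !nth_default ?size_map //= rmorph0.
Qed.

Lemma wmap_add x y : wmap (wadd x y) = wadd (wmap x) (wmap y).
Proof. by apply: wittP => n /=; rewrite zeval_comp wmap_args. Qed.

Lemma wmap_mul x y : wmap (wmul x y) = wmul (wmap x) (wmap y).
Proof. by apply: wittP => n /=; rewrite zeval_comp wmap_args. Qed.

Lemma wmap_opp x : wmap (wopp x) = wopp (wmap x).
Proof. by apply: wittP => n /=; rewrite zeval_comp wmap_args. Qed.

End Functoriality.

Section Laws.
Context (C : comNzRingType).
Implicit Types (x y z : witt pr_p C).

Let Z := zpoly (nat * nat)%type.
Let generic (u v : witt pr_p Z) :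
  (forall n, ghost p u n = ghost p v n) -> u = v.
Proof.
move=> uv; apply: wittP; apply: (@ghost_inj p) uv => n b.
have pn_gt0 : (0 < p ^ n)%N by rewrite expn_gt0 prime_gt0.
exact: (zpoly_torsionfree pn_gt0).
Qed.

Let laws := ghost_laws generic (@ghost_wzero Z) (@ghost_wone Z)
  (@ghost_wadd Z) (@ghost_wmul Z) (@ghost_wopp Z).

Let lift (l : seq (witt pr_p C)) :
  exists (f : {rmorphism Z -> C}) (X : nat -> witt pr_p Z),
    forall j, wmap f (X j) = nth (wzero C) l j.
Proof.
exists (zeval (wargs l)), (fun j => Witt pr_p (zX j)) => j.
by apply: wittP => n; rewrite /= /zX zeval_var.
Qed.

Fact waddA : associative (@wadd C).
Proof.
move=> x y z; have [f [X fX]] := lift [:: x; y; z].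
have <- : wmap f (X 0%N) = x := fX 0%N.
have <- : wmap f (X 1%N) = y := fX 1%N.
have <- : wmap f (X 2%N) = z := fX 2%N.
have [[E _ _ _] _] := laws.
by rewrite -!wmap_add E.
Qed.

Fact waddC : commutative (@wadd C).
Proof.
move=> x y; have [f [X fX]] := lift [:: x; y].
have <- : wmap f (X 0%N) = x := fX 0%N.
have <- : wmap f (X 1%N) = y := fX 1%N.
have [[_ E _ _] _] := laws.
by rewrite -!wmap_add E.
Qed.

Fact wadd0 : left_id (wzero C) (@wadd C).
Proof.
move=> x; have [f [X fX]] := lift [:: x].
have <- : wmap f (X 0%N) = x := fX 0%N.
have [[_ _ E _] _] := laws.
by rewrite -(wmap_zero f) -wmap_add E.
Qed.

Fact waddN : left_inverse (wzero C) (@wopp C) (@wadd C).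
Proof.
move=> x; have [f [X fX]] := lift [:: x].
have <- : wmap f (X 0%N) = x := fX 0%N.
have [[_ _ _ E] _] := laws.
by rewrite -(wmap_zero f) -wmap_opp -wmap_add E.
Qed.

Fact wmulA : associative (@wmul C).
Proof.
move=> x y z; have [f [X fX]] := lift [:: x; y; z].
have <- : wmap f (X 0%N) = x := fX 0%N.
have <- : wmap f (X 1%N) = y := fX 1%N.
have <- : wmap f (X 2%N) = z := fX 2%N.
have [_ [E _ _ _]] := laws.
by rewrite -!wmap_mul E.
Qed.

Fact wmulC : commutative (@wmul C).
Proof.
move=> x y; have [f [X fX]] := lift [:: x; y].
have <- : wmap f (X 0%N) = x := fX 0%N.
have <- : wmap f (X 1%N) = y := fX 1%N.
have [_ [_ E _ _]] := laws.
by rewrite -!wmap_mul E.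
Qed.

Fact wmul1 : left_id (wone C) (@wmul C).
Proof.
move=> x; have [f [X fX]] := lift [:: x].
have <- : wmap f (X 0%N) = x := fX 0%N.
have [_ [_ _ E _]] := laws.
by rewrite -(wmap_one f) -wmap_mul E.
Qed.

Fact wmulDl : left_distributive (@wmul C) (@wadd C).
Proof.
move=> x y z; have [f [X fX]] := lift [:: x; y; z].
have <- : wmap f (X 0%N) = x := fX 0%N.
have <- : wmap f (X 1%N) = y := fX 1%N.
have <- : wmap f (X 2%N) = z := fX 2%N.
have [_ [_ _ _ E]] := laws.
by rewrite -wmap_add -!wmap_mul -wmap_add E.
Qed.

HB.instance Definition _ := GRing.isZmodule.Build (witt pr_p C)
  waddA waddC wadd0 waddN.

Fact wone_neq0 : wone C != 0.
Proof.
by apply/eqP => /(congr1 (fun x : witt pr_p C => x 0%N))/eqP; rewrite oner_eq0.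
Qed.

HB.instance Definition _ := GRing.Zmodule_isComNzRing.Build (witt pr_p C)
  wmulA wmulC wmul1 wmulDl wone_neq0.

End Laws.
End WittRing.

Definition p_integral (p : nat) : {pred rat} := fun x => coprime p `|denq x|.

Fact denq_div (a b : int) : b != 0 -> (denq (a%:~R / b%:~R) %| b)%Z.
Proof.
move=> b_neq0; set x := _ / _.
have b_unit : b%:~R != 0 :> rat by rewrite intr_eq0.
have /(@intr_inj rat) E : (numq x * b)%:~R = (a * denq x)%:~R :> rat.
  by rewrite !rmorphM /= numqE mulrAC /x divfK.
have : (denq x %| numq x * b)%Z by rewrite E dvdz_mull.
by rewrite Gauss_dvdzr // coprimezE coprime_sym coprime_num_den.
Qed.

Fact p_integral_subring (p : nat) : subring_closed (p_integral p).
Proof.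
have main (x y : rat) (c : int) : x \in p_integral p -> y \in p_integral p ->
   forall z : rat, z = c%:~R / (denq x * denq y)%:~R -> z \in p_integral p.
  rewrite !unfold_in => px py z ->.
  have ne0 : denq x * denq y != 0 by rewrite mulf_neq0 ?denq_neq0.
  have := denq_div c ne0; rewrite dvdzE abszM => /coprime_dvdr; apply.
  by rewrite coprimeMr px py.
split.
- by rewrite unfold_in coprimen1.
- move=> x y px py; apply: (main _ _ (numq x * denq y - numq y * denq x) px py).
  have dx : (denq x)%:~R != 0 :> rat by rewrite intr_eq0 denq_neq0.
  have dy : (denq y)%:~R != 0 :> rat by rewrite intr_eq0 denq_neq0.
  by rewrite -{1}(divq_num_den x) -{1}(divq_num_den y) rmorphB !rmorphM /=; field; rewrite dx dy.
- move=> x y px py; apply: (main _ _ (numq x * numq y) px py).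
  have dx : (denq x)%:~R != 0 :> rat by rewrite intr_eq0 denq_neq0.
  have dy : (denq y)%:~R != 0 :> rat by rewrite intr_eq0 denq_neq0.
  by rewrite -{1}(divq_num_den x) -{1}(divq_num_den y) !rmorphM /=; field; rewrite dx dy.
Qed.

HB.instance Definition _ p := GRing.isSubringClosed.Build rat (p_integral p)
  (p_integral_subring p).

Record zloc (p : nat) := ZLoc { zloc_val :> rat; _ : zloc_val \in p_integral p }.

HB.instance Definition _ p := [isSub for @zloc_val p].
HB.instance Definition _ p := [Choice of zloc p by <:].
HB.instance Definition _ p := [SubChoice_isSubComNzRing of zloc p by <:].

(* K[v_1, v_2, ...]; the variable of index i of {cmonom nat} stands for       *)
(* v_(i+1).                                                                   *)
Notation vpoly K := {malg K[{cmonom nat}]}.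

(* the Araki generators, with v_0 = p *)
Definition araki_v (K : comNzRingType) (p i : nat) : vpoly K :=
  if i is j.+1 then << ucm j >> else p%:R.

(* V -> V \otimes Q, coefficient by coefficient *)
Definition vrat (p : nat) (f : vpoly (zloc p)) : vpoly rat :=
  \sum_(m <- monalg.msupp f) << (monalg.mcoeff m f : rat) *g m >>.

(* l is the sequence of coefficients of the logarithm: l_0 = 1 and
   p l_n = \sum_(0 <= i <= n) l_i v_(n-i)^(p^i). *)
Definition araki_log (p : nat) (l : nat -> vpoly rat) : Prop :=
  l 0%N = 1 /\
  forall n, p%:R * l n =
    \sum_(i < n.+1) l i * araki_v rat p (n - i) ^+ (p ^ i).

(* \sum_i l_i x^(p^i); at most one term contributes to each coefficient *)
Definition plog_series (A : comNzRingType) (p : nat) (l : nat -> A) : mseries 1 A :=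
  MSeries (fun m => \sum_(i < (mdeg m).+1 | (p ^ i == mdeg m)%N) l i).

(* G is the universal p-typical formal group law: over V \otimes Q its       *)
(* logarithm is \sum_i l_i x^(p^i). As V -> V \otimes Q is injective, this  *)
(* determines G.                                                              *)
Definition universal_ptypical (p : nat) (G : mseries 2 (vpoly (zloc p))) : Prop :=
  is_fgl G /\
  exists2 l, araki_log p l &
    let log := plog_series p l in
    scomp1 log (smap (@vrat p) G) = scomp1 log sx2 + scomp1 log sy2.

Section Honda.
Context (p : nat) (G : mseries 2 (vpoly (zloc p))).

(* V represents p-typical formal group laws: these are the pushforwards of G  *)
Definition ptypical (A : comNzRingType) (F : mseries 2 A) : Prop :=
  exists psi : {rmorphism vpoly (zloc p) -> A}, F = smap psi G.

Definition honda (h : nat) (H : mseries 2 'F_p) : Prop :=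
  [/\ is_fgl H, ptypical H & fgl_nseries H p = sx ^+ (p ^ h)].

End Honda.

(* base change from F_p to a ring of characteristic p *)
Definition Fp_base (p : nat) (A : comNzRingType) (a : 'F_p) : A := (a : nat)%:R.

Section LubinTate.
Context (p : nat) (pr_p : prime p) (h : nat) (k : finFieldType).

Notation W := (witt pr_p k).

Definition ltring := mseries h.-1 W.
HB.instance Definition _ := GRing.ComNzRing.on ltring.

(* the images of the Araki generators in R = W[[u_1, ..., u_(h-1)]]: p, then  *)
(* u_1, ..., u_(h-1), then 1, then 0                                          *)
Definition lt_u (i : nat) : ltring :=
  if i is j.+1 then
    if insub j is Some j' then svar (j' : 'I_h.-1) else (i == h)%:R
  else p%:R.

Definition lt_max (i : 'I_h) : ltring := lt_u i.

Definition cont_walg_hom (gamma : {rmorphism ltring -> ltring}) : Prop :=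
  (forall c : W, gamma (sconst c) = sconst c) /\
  (forall N, exists M, forall x,
     in_ideal_pow lt_max M x -> in_ideal_pow lt_max N (gamma x)).

Definition star_iso (F F' : mseries 2 ltring) (f : mseries 1 ltring) : Prop :=
  fgl_iso F F' f /\ forall m, in_ideal lt_max ((f - sx) m).

(* w is a lift of g along W -> k, with zero constant term so that it can be   *)
(* substituted into series                                                    *)
Definition is_lift (g : mseries 1 k) (w : mseries 1 W) : Prop :=
  w 0%MM = 0 /\ forall m, w m 0%N = g m.

Definition deform_coords (F : mseries 2 ltring) (g : mseries 1 k)
    (t : nat -> ltring) : Prop :=
  exists (gW gWinv : mseries 1 W) (gamma : {rmorphism ltring -> ltring})
         (psi : mseries 1 ltring),
    let gh := smap sconst gW in
    let ghinv := smap sconst gWinv in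
    let Fhat := scomp1 ghinv (scomp2 F (scomp1 gh sx2) (scomp1 gh sy2)) in
    [/\ is_lift g gW, comp_inverse gW gWinv, cont_walg_hom gamma,
        star_iso (smap gamma F) Fhat psi &
        is_fgl_sum F (fun i => sconst (t i) * sx ^+ (p ^ i)) (scomp1 gh psi)].

(* the generators p, u_1, ..., u_(h-2), u_(h-1)^(p^(h-1) + 1) *)
Definition lt_modulus (i : 'I_h) : ltring :=
  if i == h.-1 :> nat then lt_u h.-1 ^+ (p ^ h.-1 + 1) else lt_u i.

End LubinTate.

(* Main.v *)
(* For the Araki generators the p-series of F is the formal sum of the        *)
(* u_i x^(p^i). As h_g is a homomorphism from g_*F to F, it intertwines the   *)
(* two p-series, which gives an equality of formal sums over F                *)
(*   \sum^F_(i,j) t_i g_*(u_j)^(p^i) x^(p^(i+j))                              *)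
(*     = \sum^F_(i,j) u_j t_i^(p^j) x^(p^(i+j)).                              *)
(* Modulo (p, u_1, ..., u_(h-2)) the terms of lowest degree p^(h-1) give      *)
(* t_0 g_*(u_(h-1)) = u_(h-1) t_0^(p^(h-1)) and cancel. Comparing the         *)
(* coefficients of x^(p^(2h-1)) gives the result: in degrees up to q =        *)
(* p^(h-1), F(x, y) is x + y - u_(h-1) ((x + y)^q - x^q - y^q) / p, so the    *)
(* two terms of degree p^h on each side contribute a correction, and on the   *)
(* left-hand side this correction, like t_h g_*(u_(h-1))^(p^h), is divisible  *)
(* by u_(h-1)^(p^(h-1)+1).                                                    *)

Require Import Defs.
From HB Require Import structures.
From mathcomp Require Import all_boot all_order all_algebra.
From mathcomp Require Import boolp finmap.
From mathcomp Require Import ring zify.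
From mathcomp Require Import monalg.
From mathcomp Require Import mpoly.

Set Implicit Arguments.
Unset Strict Implicit.
Unset Printing Implicit Defensive.

Import Order.TTheory GRing.Theory Num.Theory.
Local Open Scope ring_scope.

(** * Substitution in power series *)

(** Write m = h - 1, q = p^m, P = p^h, and C_q(x,y) = ((x+y)^q - x^q - y^q)/p, which is
    [binsum p q]. The deformation data enter through one fact: [h_g] is a homomorphism from the
    twisted law to F with invertible linear coefficient t_0 ([conj_fgl_hom]). It therefore commutes
    with multiplication by p.

    For the Araki generators, [p]_F(x) is the formal sum of the u_j x^(p^j). This is seen on
    logarithms over V \otimes Q ([plog_pseries]) and carried to every p-typical law
    ([ptypical_pseries]). Inserting the expansion of [h_g], [pseries_compare] obtains an equality of
    two formal sums over F, with terms t_i b_j^(p^i) x^(p^(i+j)) and u_j t_i^(p^j) x^(p^(i+j)),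
    where b_j is the image of u_j under the twist.

    The comparison takes place in the quotient A of R by the ideal, where u_j = 0 for j < m and u =
    u_m satisfies u^(q+1) = 0. Degrees up to q give b_j = 0 for j < m and t_0 b = u t_0^q for b =
    b_m, so u divides b. The terms of degree q agree and cancel in the formal group ([fadd_cancel]);
    what remains starts in degree P. In the coefficient of x^(Pq) the only nonlinear effect of F is
    its leading form F = x + y - u C_q(x,y) through degree q ([ptypical_lead]), applied to the two
    terms of degree P ([Fsum_split]). The result is [top_coef]: t_h b^P + t_m - u C_q(t_0, t_1 b^p)
    = u t_h^q + t_m^P - u C_q(t_0^P, u t_1^q). In characteristic p, C_q(x,y) = C_p(x^(q/p), y^(q/p))
    ([binsum_pchar]). Hence the correction on the left is a multiple of u b^q, so of u^(q+1), and
    vanishes together with b^P; the correction on the right expands to the stated sum.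

    All identities of series are handled as congruences below a given degree, [sord d (f - g)]. *)

Section Series.
Context (n : nat) (A : comNzRingType).
Implicit Types (f g : mseries n A) (m : 'X_{1..n}).

Lemma scoef0 m : (0 : mseries n A) m = 0.
Proof. by rewrite /= mul0rn. Qed.

Lemma scoefD f g m : (f + g) m = f m + g m.
Proof. by []. Qed.

Lemma scoefB f g m : (f - g) m = f m - g m.
Proof. by []. Qed.

Lemma scoef_sum (I : Type) (r : seq I) (P : pred I) (f : I -> mseries n A) m :
  (\sum_(i <- r | P i) f i) m = \sum_(i <- r | P i) f i m.
Proof. by elim/big_rec2: _ => [|i x y _ <-] //; rewrite scoef0. Qed.

Lemma scoefM d (P Q : mpoly n A) f g m : (mdeg m < d)%N ->
  (forall k, (mdeg k < d)%N -> P@_k = f k) ->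
  (forall k, (mdeg k < d)%N -> Q@_k = g k) ->
  (f * g) m = (P * Q)@_m.
Proof. exact: smulE. Qed.

Lemma sconst_is_zmod_morphism : zmod_morphism (@sconst n A).
Proof. by move=> a b; apply: seriesP => m /=; rewrite mulrnBl. Qed.

Lemma sconst_mulE c f m : (sconst c * f) m = c * f m.
Proof.
rewrite (@scoefM (mdeg m).+1 c%:MP (strunc (mdeg m).+1 f)) ?mcoeffCM //.
- by rewrite mcoeff_strunc.
- by move=> k _; rewrite mcoeffC mulr_natr.
- by move=> k; apply: mcoeff_strunc.
Qed.

Lemma sconst_is_monoid_morphism : monoid_morphism (@sconst n A).
Proof.
split=> [|a b]; first by apply: seriesP.
by apply: seriesP => m; rewrite sconst_mulE /= mulrnAr.
Qed.

HB.instance Definition _ := GRing.isZmodMorphism.Build A (mseries n A)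
  (@sconst n A) sconst_is_zmod_morphism.
HB.instance Definition _ := GRing.isMonoidMorphism.Build A (mseries n A)
  (@sconst n A) sconst_is_monoid_morphism.

(* f and g agree below degree d when sord d (f - g). *)
Definition sord d f := forall m, (mdeg m < d)%N -> f m = 0.

Lemma sord0 d : sord d 0.
Proof. by move=> m _; rewrite scoef0. Qed.

Lemma sordD d f g : sord d f -> sord d g -> sord d (f + g).
Proof. by move=> of_ og m lt_md; rewrite /= of_ ?og ?addr0. Qed.

Lemma sordN d f : sord d f -> sord d (- f).
Proof. by move=> of_ m lt_md; rewrite /= of_ ?oppr0. Qed.

Lemma sordB d f g : sord d f -> sord d g -> sord d (f - g).
Proof. by move=> of_ og; apply: sordD => //; apply: sordN. Qed.

Lemma sord_sum d (I : eqType) (r : seq I) (P : pred I) (f : I -> mseries n A) :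
  (forall i, P i -> sord d (f i)) -> sord d (\sum_(i <- r | P i) f i).
Proof. by move=> of_; apply: big_ind => //; [apply: sord0|apply: sordD]. Qed.

Lemma sord_le d e f : (d <= e)%N -> sord e f -> sord d f.
Proof. by move=> le_de of_ m lt_md; apply: of_; apply: leq_trans le_de. Qed.

Lemma sordM d e f g : sord d f -> sord e g -> sord (d + e) (f * g).
Proof.
move=> of_ og m lt_m.
rewrite [(f * g) m]/=; apply: big1 => -[k l] /= /eqP Em.
have [lt_kd|le_dk] := ltnP (mdeg k) d; first by rewrite of_ ?mul0r.
rewrite og ?mulr0 // -(ltn_add2l (mdeg k)) -mdegD -Em.
by apply: leq_trans lt_m _; rewrite leq_add2r.
Qed.

Lemma sordMl d f g : sord d f -> sord d (f * g).
Proof. by move=> of_; rewrite -(addn0 d); apply: sordM. Qed.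

Lemma sordMr d f g : sord d g -> sord d (f * g).
Proof. by move=> og; rewrite mulrC; apply: sordMl. Qed.

Lemma sordX d f e : sord d f -> sord (d * e) (f ^+ e).
Proof.
move=> of_; elim: e => [|e IHe]; first by rewrite muln0.
by rewrite exprS mulnS; apply: sordM.
Qed.

Lemma sord_svar i : sord 1 (svar i : mseries n A).
Proof.
move=> m; rewrite ltnS leqn0 mdeg_eq0 => /eqP -> /=.
by rewrite eq_sym mnm1_eq0.
Qed.

Lemma sord1P f : reflect (sord 1 f) (f 0%MM == 0).
Proof.
apply: (iffP eqP) => [f0 m|]; last by apply; rewrite mdeg0.
by rewrite ltnS leqn0 mdeg_eq0 => /eqP ->.
Qed.

Lemma sord_coef d f g m : sord d (f - g) -> (mdeg m < d)%N -> f m = g m.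
Proof. by move=> ofg lt_md; apply/eqP; rewrite -subr_eq0 -scoefB ofg. Qed.

Lemma sord_eq f g : (forall d, sord d (f - g)) -> f = g.
Proof. by move=> E; apply: seriesP => m; apply: (sord_coef (E (mdeg m).+1)). Qed.

Lemma sord_refl d f : sord d (f - f).
Proof. by rewrite subrr; apply: sord0. Qed.

Lemma sord_sym d f g : sord d (f - g) -> sord d (g - f).
Proof. by move=> ofg; rewrite -opprB; apply: sordN. Qed.

Lemma sord_trans d f g l : sord d (f - g) -> sord d (g - l) -> sord d (f - l).
Proof. by move=> fg gl; rewrite -(subrKA g); apply: sordD. Qed.

Lemma sord_subD d f f' g g' :
  sord d (f - f') -> sord d (g - g') -> sord d (f + g - (f' + g')).
Proof. by move=> of_ og; rewrite opprD addrACA; apply: sordD. Qed.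

Lemma sord_subB d f f' g g' :
  sord d (f - f') -> sord d (g - g') -> sord d (f - g - (f' - g')).
Proof.
by move=> of_ og; apply: sord_subD => //; rewrite -opprD; apply: sordN.
Qed.

Lemma sord_subM d f f' g g' :
  sord d (f - f') -> sord d (g - g') -> sord d (f * g - f' * g').
Proof.
move=> of_ og; rewrite -(subrKA (f' * g)) -mulrBl -mulrBr.
by apply: sordD; [apply: sordMl | apply: sordMr].
Qed.

Lemma sord_subX d f f' e : sord d (f - f') -> sord d (f ^+ e - f' ^+ e).
Proof.
move=> of_; elim: e => [|e IHe]; first exact: sord_refl.
by rewrite !exprS; apply: sord_subM.
Qed.

(** Relative precision: if both factors are known up to e degrees beyond their leading degrees, so
    is the product. This is what allows leading coefficients to be read off from powers and
    products. *)
Lemma sord_subM_lead c d e f f' g g' : sord c f' -> sord d g ->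
    sord (c + e) (f - f') -> sord (d + e) (g - g') ->
  sord (c + d + e) (f * g - f' * g').
Proof.
move=> cf dg df dgg; rewrite -(subrKA (f' * g)) -mulrBl -mulrBr.
by apply: sordD; [rewrite addnAC | rewrite -addnA]; apply: sordM.
Qed.

Lemma sord_subX_lead c e f f' k : sord c f -> sord c f' ->
  sord (c + e) (f - f') -> sord (c * k + e) (f ^+ k - f' ^+ k).
Proof.
move=> cf cf' df; elim: k => [|k IHk]; first exact: sord_refl.
by rewrite !exprS mulnS; apply: sord_subM_lead => //; apply: sordX.
Qed.

End Series.

Arguments sord {n A}.
#[global] Hint Resolve sord0 sord_refl : core.

Section Evaluation.
Context (n q : nat) (A : comNzRingType).
Implicit Types (f : mseries n A) (g : 'I_n -> mseries q A).
Implicit Types (P Q : mpoly n A) (e : 'X_{1..n}).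

Notation ev g := (mpoly.mmap (@sconst q A) g).

Lemma sord_mmap1 g e : (forall i, sord 1 (g i)) -> sord (mdeg e) (mmap1 g e).
Proof.
move=> og; rewrite mdegE /mmap1.
elim/big_rec2: _ => // i d s _ ods; apply: sordM => //.
by rewrite -{1}[e i]mul1n; apply: sordX.
Qed.

Lemma sord_ev g d P : (forall i, sord 1 (g i)) ->
  (forall e, (mdeg e < d)%N -> P@_e = 0) -> sord d (ev g P).
Proof.
move=> og P0; rewrite /mpoly.mmap; apply: sord_sum => e _.
have [lt_ed|le_de] := ltnP (mdeg e) d; first by rewrite P0 // rmorph0 mul0r.
by apply: sordMr; apply: sord_le le_de _; apply: sord_mmap1.
Qed.

(** Below a fixed degree, substitution is evaluation of a polynomial truncation. Evaluation is a
    ring morphism, so the multiplicativity and associativity of substitution follow from this by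
    truncating far enough. *)
Lemma scomp_ev d f g P k : (forall i, sord 1 (g i)) ->
  (forall e, (mdeg e < d)%N -> P@_e = f e) -> (mdeg k < d)%N ->
  scomp f g k = ev g P k.
Proof.
move=> og Pf lt_kd; pose d' := (mdeg k).+1.
have -> : scomp f g k = ev g (strunc d' f) k.
  rewrite /strunc raddf_sum /= scoef_sum; apply: eq_bigr => e _.
  by rewrite mmapZ mpoly.mmapX sconst_mulE.
apply: (@sord_coef _ _ d') => //; rewrite -rmorphB; apply: sord_ev => // e lt_ed.
by rewrite mpoly.mcoeffB mcoeff_strunc // Pf ?subrr //; apply: leq_trans lt_kd.
Qed.

Lemma sord_scomp_ev d f g P : (forall i, sord 1 (g i)) ->
  (forall e, (mdeg e < d)%N -> P@_e = f e) -> sord d (scomp f g - ev g P).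
Proof.
by move=> og Pf k lt_kd; rewrite scoefB (scomp_ev og Pf lt_kd) subrr.
Qed.

Lemma sord_scomp_trunc d f g : (forall i, sord 1 (g i)) ->
  sord d (scomp f g - ev g (strunc d f)).
Proof. by move=> og; apply: sord_scomp_ev => // e; apply: mcoeff_strunc. Qed.

Lemma scompB f f' g : scomp (f - f') g = scomp f g - scomp f' g.
Proof.
apply: seriesP => k; rewrite /= -sumrN -big_split /=.
by apply: eq_bigr => e _; rewrite mulrDl mulNr.
Qed.

Lemma scompN f g : scomp (- f) g = - scomp f g.
Proof. by rewrite -sub0r scompB -{1}(subrr 0) scompB subrr sub0r. Qed.

Lemma scompD f f' g : scomp (f + f') g = scomp f g + scomp f' g.
Proof. by rewrite -{1}(opprK f') scompB scompN opprK. Qed.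

Lemma scomp0 g : scomp 0 g = 0.
Proof. by rewrite -(subrr 0) scompB subrr. Qed.

Lemma scomp_sum (I : Type) (r : seq I) (P : pred I) (f : I -> mseries n A) g :
  scomp (\sum_(i <- r | P i) f i) g = \sum_(i <- r | P i) scomp (f i) g.
Proof.
elim/big_rec2: _ => [|i x y _ <-]; [exact: scomp0 | exact: scompD].
Qed.

Section OrderOne.
Context (g : 'I_n -> mseries q A) (og : forall i, sord 1 (g i)).

Lemma scomp_sconst c : scomp (sconst c) g = sconst c.
Proof.
apply: seriesP => k; rewrite (@scomp_ev (mdeg k).+1 _ _ c%:MP) ?mpoly.mmapC //.
by move=> e _; rewrite mcoeffC mulr_natr.
Qed.

Lemma scomp_one : scomp 1 g = 1.
Proof. by rewrite -(rmorph1 (@sconst n A)) scomp_sconst rmorph1. Qed.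

Lemma scomp_svar i : scomp (svar i) g = g i.
Proof.
apply: seriesP => k; rewrite (@scomp_ev (mdeg k).+1 _ _ 'X_i) ?mpoly.mmapX ?mmap1U //.
by move=> e _; rewrite mcoeffX eq_sym.
Qed.

Lemma scompM f f' : scomp (f * f') g = scomp f g * scomp f' g.
Proof.
apply: sord_eq => d; apply: sord_trans _ (sord_subM (sord_sym (sord_scomp_trunc f og))
  (sord_sym (sord_scomp_trunc f' og))); rewrite -rmorphM.
apply: sord_scomp_ev => // e lt_ed; symmetry.
by apply: scoefM lt_ed _ _ => *; apply: mcoeff_strunc.
Qed.

Lemma scompX f (e : nat) : scomp (f ^+ e) g = scomp f g ^+ e.
Proof. by elim: e => [|e IHe]; rewrite ?scomp_one // !exprS scompM IHe. Qed.

Lemma scomp_prod (I : Type) (r : seq I) (P : pred I) (f : I -> mseries n A) :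
  scomp (\prod_(i <- r | P i) f i) g = \prod_(i <- r | P i) scomp (f i) g.
Proof.
elim/big_rec2: _ => [|i x y _ <-]; [exact: scomp_one | exact: scompM].
Qed.

Lemma sord_scomp d f : sord d f -> sord d (scomp f g).
Proof.
move=> of_; rewrite -[scomp f g]subr0 -(rmorph0 (ev g)).
by apply: sord_scomp_ev => // e lt_ed; rewrite mpoly.mcoeff0 of_.
Qed.

Lemma sord_scompM c d f : (0 < c)%N -> (forall i, sord c (g i)) ->
  sord d f -> sord (c * d) (scomp f g).
Proof.
move=> c_gt0 cg df; rewrite -[scomp f g](subrK (ev g (strunc (c * d) f))).
apply: sordD; first exact: sord_scomp_trunc.
apply: sord_sum => e _; have [lt_ed|le_de] := ltnP (mdeg e) d.
  rewrite mcoeff_strunc ?df ?rmorph0 ?mul0r //.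
  by apply: leq_trans lt_ed _; apply: leq_pmull.
apply/sordMr/(sord_le (e := c * mdeg e)); first by rewrite leq_pmul2l.
rewrite mdegE /mmap1; elim/big_rec2: _ => [|i x y _ xy]; first by rewrite muln0.
by rewrite mulnDr; apply: sordM => //; apply: sordX.
Qed.

Lemma sord_subscomp d f f' : sord d (f - f') -> sord d (scomp f g - scomp f' g).
Proof. by rewrite -scompB; apply: sord_scomp. Qed.

(* The first-order Taylor expansion of f at g'. *)
Lemma sord_scomp_diff d f g' : (forall i, sord 1 (g' i)) -> (0 < d)%N ->
    (forall i, sord d (g i - g' i)) ->
  sord d.+1 (scomp f g - scomp f g' -
            \sum_i sconst (f U_(i)%MM) * (g i - g' i)).
Proof.
move=> og' d_gt0 dg.
suff ev_diff : sord d.+1 (ev g (strunc d.+1 f) - ev g' (strunc d.+1 f) -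
    \sum_i sconst (f U_(i)%MM) * (g i - g' i)).
  by apply: sord_trans _ ev_diff; apply: sord_subB; apply: sord_scomp_trunc.
have -> : \sum_i sconst (f U_(i)%MM) * (g i - g' i) =
    \sum_(e : 'X_{1..n < d.+1}) sconst (f e) *
      \sum_(i | U_(i)%MM == e :> 'X_{1..n}) (g i - g' i).
  rewrite [RHS](eq_bigr (fun e : 'X_{1..n < d.+1} =>
     \sum_i sconst ((f e) * (val e == U_(i)%MM)%:R) * (g i - g' i))); last first.
    move=> e _; rewrite mulr_sumr big_mkcond; apply: eq_bigr => i _.
    by rewrite eq_sym; case: eqP => _; rewrite ?mulr1 // mulr0 rmorph0 mul0r.
  rewrite exchange_big; apply: eq_bigr => i _ /=.
  rewrite -mulr_suml -rmorph_sum; congr (sconst _ * _).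
  rewrite -[LHS](@mcoeff_strunc _ _ d.+1) ?mdeg1 // /strunc raddf_sum /=.
  by apply: eq_bigr => e _; rewrite mcoeffZ mcoeffX.
have evE l : ev l (strunc d.+1 f) =
    \sum_(e : 'X_{1..n < d.+1}) sconst (f e) * mmap1 l e.
  by rewrite /strunc raddf_sum; apply: eq_bigr => e _; rewrite /= mmapZ mpoly.mmapX.
rewrite !evE -!sumrB; apply: sord_sum => e _; rewrite -!mulrBr.
apply: sordMr; case: e => e /= _.
(* Monomial by monomial: constants cancel, a linear monomial is matched exactly by its term of the
   sum, and X_i X^e' with e' nonzero differs by order d + 1, since a factor of order at least one
   accompanies the difference of order d. *)
have [e0|e_neq0] := eqVneq e 0%MM.
  rewrite e0 !mmap11 subrr sub0r big_pred0 ?oppr0 // => i.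
  by rewrite mnm1_eq0.
have [i e_i] : exists i, (U_(i)%MM <= e)%MM.
  case: (pickP (fun i => e i != 0%N)) => [i e_i|e0].
    by exists i; rewrite lep1mP.
  by case/eqP: e_neq0; apply/mnmP => i; rewrite mnm0E; apply/eqP/negbFE/e0.
have [e' ->] : exists e', e = (U_(i) + e')%MM.
  by exists (e - U_(i))%MM; rewrite addmC submK.
have mmap1M (l : 'I_n -> mseries q A) : mmap1 l (U_(i) + e')%MM = l i * mmap1 l e'.
  by rewrite commr_mmap1_M ?mmap1U // => *; apply: mulrC.
rewrite !mmap1M.
have dmon (e1 : 'X_{1..n}) : sord d (mmap1 g e1 - mmap1 g' e1).
  rewrite /mmap1; elim/big_rec2: _ => // j x y _ dxy.
  by apply: sord_subM dxy; apply: sord_subX.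
have [->|e'_neq0] := eqVneq e' 0%MM.
  rewrite !mmap11 !mulr1 addm0 (big_pred1 i) ?subrr // => j.
  by rewrite eq_mnm1.
rewrite big_pred0 ?subr0 => [|j]; last first.
  apply/eqP => /(congr1 mdeg)/eqP; rewrite mdegD !mdeg1 -[X in X == _]addn0.
  by rewrite eqn_add2l eq_sym mdeg_eq0 (negPf e'_neq0).
have oe' (l : 'I_n -> mseries q A) : (forall i, sord 1 (l i)) -> sord 1 (mmap1 l e').
  by move=> ol; apply: sord_le _ (sord_mmap1 (e := e') ol); rewrite lt0n mdeg_eq0.
rewrite -(subrKA (g' i * mmap1 g e')) -mulrBl -mulrBr.
apply: sordD; first by rewrite -addn1; apply: sordM => //; apply: oe'.
by rewrite -add1n; apply: sordM.
Qed.

Lemma sord_subscompr d f g' : (forall i, sord 1 (g' i)) ->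
  (forall i, sord d (g i - g' i)) -> sord d (scomp f g - scomp f g').
Proof.
move=> og' dg; have [->|d_gt0] := posnP d; first by [].
rewrite -(subrK (\sum_i sconst (f U_(i)%MM) * (g i - g' i)) (_ - _)).
apply: sordD; first exact: sord_le (leqnSn d) (sord_scomp_diff f og' d_gt0 dg).
by apply: sord_sum => i _; apply: sordMr.
Qed.

End OrderOne.

End Evaluation.

Section Composition.
Context (n q r : nat) (A : comNzRingType).

Lemma scompA (f : mseries n A) (g : 'I_n -> mseries q A) (l : 'I_q -> mseries r A) :
  (forall i, sord 1 (g i)) -> (forall i, sord 1 (l i)) ->
  scomp (scomp f g) l = scomp f (fun i => scomp (g i) l).
Proof.
move=> og ol; have ogl i : sord 1 (scomp (g i) l) by apply: sord_scomp.
apply: sord_eq => d.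
apply: sord_trans (sord_subscomp ol (sord_scomp_trunc f og)) _.
apply: sord_sym; apply: sord_trans (sord_scomp_trunc f ogl) _.
rewrite /mpoly.mmap scomp_sum // (_ : _ - _ = 0) //; apply/eqP; rewrite subr_eq0.
apply/eqP/eq_bigr => e _; rewrite scompM // scomp_sconst // scomp_prod //.
by congr (_ * _); apply: eq_bigr => i _; rewrite scompX.
Qed.

End Composition.

Section ScompExt.
Context (n q : nat) (A : comNzRingType).

Lemma eq_scomp (f : mseries n A) (g g' : 'I_n -> mseries q A) :
  g =1 g' -> scomp f g = scomp f g'.
Proof. by move=> /funext ->. Qed.

End ScompExt.

(** * Change of the coefficient ring *)

Section Smap.
Context (A B : comNzRingType) (f : {rmorphism A -> B}).

Section Arity.
Context (n : nat).

Lemma smap_is_zmod_morphism : zmod_morphism (@smap n A B f).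
Proof. by move=> a b; apply: seriesP => m /=; rewrite rmorphB. Qed.

Lemma smap_is_monoid_morphism : monoid_morphism (@smap n A B f).
Proof.
split=> [|a b]; apply: seriesP => m /=; first by rewrite rmorphMn rmorph1.
by rewrite rmorph_sum; apply: eq_bigr => k _; rewrite rmorphM.
Qed.

HB.instance Definition _ := GRing.isZmodMorphism.Build (mseries n A) (mseries n B)
  (@smap n A B f) smap_is_zmod_morphism.
HB.instance Definition _ := GRing.isMonoidMorphism.Build (mseries n A) (mseries n B)
  (@smap n A B f) smap_is_monoid_morphism.

Lemma smapD (a b : mseries n A) : smap f (a + b) = smap f a + smap f b.
Proof. exact: rmorphD. Qed.

Lemma smapB (a b : mseries n A) : smap f (a - b) = smap f a - smap f b.
Proof. exact: rmorphB. Qed.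

Lemma smapM (a b : mseries n A) : smap f (a * b) = smap f a * smap f b.
Proof. exact: rmorphM. Qed.

Lemma smapX (a : mseries n A) k : smap f (a ^+ k) = smap f a ^+ k.
Proof. exact: rmorphXn. Qed.

Lemma sord_smap d (s : mseries n A) : sord d s -> sord d (smap f s).
Proof. by move=> os m lt_md; rewrite /= os // rmorph0. Qed.

Lemma smap_svar i : smap f (svar i) = svar i :> mseries n B.
Proof. by apply: seriesP => m /=; rewrite rmorph_nat. Qed.

Lemma smap_sconst c : smap f (sconst c) = sconst (f c) :> mseries n B.
Proof. by apply: seriesP => m /=; rewrite rmorphMn. Qed.

End Arity.

Lemma smap_scomp n q (s : mseries n A) (g : 'I_n -> mseries q A) :
  smap f (scomp s g) = scomp (smap f s) (fun i => smap f (g i)).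
Proof.
apply: seriesP => m /=; rewrite rmorph_sum; apply: eq_bigr => e _.
rewrite rmorphM; congr (_ * _).
have := congr1 (fun s : mseries q B => s m) (rmorph_prod (smap f) (index_enum 'I_n) predT
  (fun i => g i ^+ (val e) i)) => /= ->.
by congr (scoef _ m); apply: eq_bigr => i _; rewrite rmorphXn.
Qed.

End Smap.

(** * The group of a formal group law *)

Lemma svarXE n (A : comNzRingType) (i : 'I_n) k (m : 'X_{1..n}) :
  (svar i ^+ k : mseries n A) m = (m == (U_(i) *+ k)%MM)%:R.
Proof.
elim: k m => [|k IHk] m; first by rewrite expr0 mulm0n.
rewrite exprS (@scoefM _ _ (mdeg m).+1 'X_i 'X_[U_(i) *+ k]) //.
- by rewrite -mpolyXD -mulmS mcoeffX eq_sym.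
- by move=> e _; rewrite mcoeffX eq_sym.
- by move=> e _; rewrite mcoeffX IHk eq_sym.
Qed.

Definition mon1 (k : nat) : 'X_{1..1} := (U_(ord0) *+ k)%MM.

Lemma mdeg_mon1 k : mdeg (mon1 k) = k.
Proof. by rewrite /mon1 mdegMn mdeg1 mul1n. Qed.

Lemma mon1_mdeg m : m = mon1 (mdeg m).
Proof.
by apply/mnmP => i; rewrite ord1 /mon1 mulmnE mnm1E eqxx mul1n mdegE big_ord1.
Qed.

Lemma mon1_inj : injective mon1.
Proof. by move=> i j /(congr1 mdeg); rewrite !mdeg_mon1. Qed.

Lemma sord_mon1 (A : comNzRingType) d (f : mseries 1 A) :
  (forall k, (k < d)%N -> f (mon1 k) = 0) -> sord d f.
Proof. by move=> f0 m lt_md; rewrite (mon1_mdeg m) f0. Qed.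

Lemma scoef_monomial (A : comNzRingType) (c : A) k j :
  (sconst c * sx ^+ k) (mon1 j) = c *+ (j == k)%N.
Proof.
by rewrite sconst_mulE svarXE -/(mon1 k) (inj_eq mon1_inj) mulr_natr.
Qed.

Lemma scoef_sx (A : comNzRingType) : sx (mon1 1) = 1 :> A.
Proof. by rewrite /= /mon1 mulm1n eqxx. Qed.

Section Binary.
Context (A : comNzRingType).
Implicit Types (F : mseries 2 A).

Lemma sord_if (q d : nat) (a b : mseries q A) (P : bool) :
  sord d a -> sord d b -> sord d (if P then a else b).
Proof. by case: P. Qed.

Lemma scomp2_scomp q r F (a b : mseries q A) (g : 'I_q -> mseries r A) :
  sord 1 a -> sord 1 b -> (forall i, sord 1 (g i)) ->
  scomp (scomp2 F a b) g = scomp2 F (scomp a g) (scomp b g).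
Proof.
move=> oa ob og; rewrite /scomp2 scompA // => [|i]; last exact: sord_if.
by apply: eq_scomp => i; case: ifP.
Qed.

Lemma sord_scomp2 q F (a b : mseries q A) :
  F 0%MM = 0 -> sord 1 a -> sord 1 b -> sord 1 (scomp2 F a b).
Proof.
move=> F0 oa ob; apply: sord_scomp => [i|]; first exact: sord_if.
by apply/sord1P/eqP.
Qed.

Lemma sord_scomp2_diff q d F (a a' b b' : mseries q A) : (0 < d)%N ->
    sord 1 a -> sord 1 b -> sord 1 a' -> sord 1 b' ->
    sord d (a - a') -> sord d (b - b') ->
  sord d.+1 (scomp2 F a b - scomp2 F a' b' -
    (sconst (F U_(ord0)%MM) * (a - a') + sconst (F U_(ord_max)%MM) * (b - b'))).
Proof.
move=> d_gt0 oa ob oa' ob' da db.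
have -> : sconst (F U_(ord0)%MM) * (a - a') + sconst (F U_(ord_max)%MM) * (b - b') =
    \sum_i sconst (F U_(i)%MM) *
      ((if i == ord0 then a else b) - if i == ord0 then a' else b').
  have -> : ord_max = lift ord0 ord0 :> 'I_2 by apply: val_inj.
  by rewrite big_ord_recl big_ord1.
by apply: sord_scomp_diff => // i; case: ifP.
Qed.

Lemma smap_scomp2 (B : comNzRingType) (f : {rmorphism A -> B}) q F (a b : mseries q A) :
  smap f (scomp2 F a b) = scomp2 (smap f F) (smap f a) (smap f b).
Proof. by rewrite /scomp2 smap_scomp; apply: eq_scomp => i; case: ifP. Qed.

Lemma smap_scomp1 (B : comNzRingType) (f : {rmorphism A -> B}) q
    (s : mseries 1 A) (a : mseries q A) :
  smap f (scomp1 s a) = scomp1 (smap f s) (smap f a).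
Proof. exact: smap_scomp. Qed.

Lemma smap_fgl (B : comNzRingType) (f : {rmorphism A -> B}) F :
  is_fgl F -> is_fgl (smap f F).
Proof.
case=> idr idl comm assoc; split.
- by have := congr1 (smap f) idr; rewrite smap_scomp2 rmorph0 smap_svar.
- by have := congr1 (smap f) idl; rewrite smap_scomp2 rmorph0 smap_svar.
- by have := congr1 (smap f) comm; rewrite smap_scomp2 !smap_svar.
- by have := congr1 (smap f) assoc; rewrite !smap_scomp2 !smap_svar.
Qed.

End Binary.

(* Power series without constant term, the carrier of the group defined by a  *)
(* formal group law; zs sends every other series to the junk value 0.         *)
Definition zser (q : nat) (A : comNzRingType) := {s : mseries q A | s 0%MM == 0}.

Section Zser.
Context (q : nat) (A : comNzRingType).

Lemma zser0_subproof : (0 : mseries q A) 0%MM == 0.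
Proof. by rewrite scoef0. Qed.

Definition zser0 : zser q A := exist (fun s : mseries q A => is_true (s 0%MM == 0)) _ zser0_subproof.
Definition zs (s : mseries q A) : zser q A := insubd zser0 s.

Lemma sord_zser (a : zser q A) : sord 1 (val a).
Proof. exact/sord1P/(valP a). Qed.

Lemma val_zs s : sord 1 s -> val (zs s) = s.
Proof. by move/sord1P => s0; rewrite /zs insubdK. Qed.

Lemma zs_val a : zs (val a) = a.
Proof. exact: valKd. Qed.

End Zser.
#[global] Hint Resolve sord_zser sord_svar : core.

Section FormalGroup.
Context (A : comNzRingType) (F : mseries 2 A) (HF : is_fgl F).

Lemma scomp_F00 q : scomp2 F 0 0 = 0 :> mseries q A.
Proof.
case: HF => idr _ _ _.
have := congr1 (fun s : mseries 1 A => scomp s (fun _ => 0 : mseries q A)) idr.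
by rewrite scomp2_scomp // !scomp_svar // scomp0.
Qed.

Lemma fgl_coef0 : F 0%MM = 0.
Proof.
(* Both branches are 0; the conditional only reproduces the shape of [scomp2 F 0 0]. *)
pose g (i : 'I_2) : mseries 1 A := if i == ord0 then 0 else 0.
have og i : sord 1 (g i) by apply: sord_if.
have E : scomp F g = 0 := scomp_F00 1.
have oF : sord 1 (scomp (F - sconst (F 0%MM)) g).
  by apply: sord_scomp => //; apply/sord1P; rewrite scoefB /= eqxx mulr1n subrr.
move/sord1P: oF; rewrite scompB E scomp_sconst // scoefB scoef0 sub0r /=.
by rewrite eqxx mulr1n oppr_eq0 => /eqP.
Qed.

Lemma fgl_coefU0 : F U_(ord0)%MM = 1.
Proof.
case: HF => idr _ _ _; have := @sord_scomp2_diff A 1 1 F sx 0 0 0 isT.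
rewrite idr scomp_F00 !subr0 mulr0 addr0.
move/(_ (@sord_svar _ _ _) (@sord0 _ _ _) (@sord0 _ _ _) (@sord0 _ _ _)).
move/(_ (@sord_svar _ _ _) (@sord0 _ _ _) (mon1 1)); rewrite mdeg_mon1 => /(_ isT)/eqP.
by rewrite scoefB sconst_mulE scoef_sx mulr1 subr_eq0 => /eqP <-.
Qed.

Lemma fgl_coefU1 : F U_(ord_max)%MM = 1.
Proof.
case: HF => _ idl _ _; have := @sord_scomp2_diff A 1 1 F 0 0 sx 0 isT.
rewrite idl scomp_F00 !subr0 mulr0 add0r.
move/(_ (@sord0 _ _ _) (@sord_svar _ _ _) (@sord0 _ _ _) (@sord0 _ _ _)).
move/(_ (@sord0 _ _ _) (@sord_svar _ _ _) (mon1 1)); rewrite mdeg_mon1 => /(_ isT)/eqP.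
by rewrite scoefB sconst_mulE scoef_sx mulr1 subr_eq0 => /eqP <-.
Qed.

Section Arity.
Context (q : nat).
Implicit Types (a b c : zser q A).

Fact fadd_subproof a b : (scomp2 F (val a) (val b)) 0%MM == 0.
Proof. by apply/sord1P/sord_scomp2 => //; apply: fgl_coef0. Qed.

Definition fadd a b : zser q A := exist (fun s : mseries q A => is_true (s 0%MM == 0)) _ (fadd_subproof a b).

Lemma val_fadd a b : val (fadd a b) = scomp2 F (val a) (val b).
Proof. by []. Qed.

Fact faddC : commutative fadd.
Proof.
move=> a b; apply: val_inj => /=; case: HF => _ _ comm _.
pose g (i : 'I_2) := if i == ord0 then val b else val a.
have og i : sord 1 (g i) by apply: sord_if.
have := congr1 (fun s : mseries 2 A => scomp s g) comm.
by rewrite scomp2_scomp ?scomp_svar //.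
Qed.

Fact fadd0 : left_id (zser0 q A) fadd.
Proof.
move=> a; apply: val_inj => /=; case: HF => _ idl _ _.
have := congr1 (fun s : mseries 1 A => scomp s (fun _ => val a)) idl.
by rewrite scomp2_scomp ?scomp_svar ?scomp0 //.
Qed.

Fact faddA : associative fadd.
Proof.
move=> a b c; apply: val_inj => /=; case: HF => _ _ _ /=.
set x := svar _; set y := svar _; set z := svar _ => assoc.
pose g (i : 'I_3) := if i == 0%N :> nat then val a else if i == 1%N :> nat then val b else val c.
have og i : sord 1 (g i) by do 2!apply: sord_if => //.
have F0 := fgl_coef0.
have [ox oy oz] : [/\ sord 1 x, sord 1 y & sord 1 z] by split; apply: sord_svar.
have := congr1 (fun s : mseries 3 A => scomp s g) assoc.
rewrite !scomp2_scomp ?scomp_svar //; try exact: sord_scomp2.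
by rewrite /g !inordK // => /esym.
Qed.

(** Finite formal sums become big operators, so they can be split, reindexed and exchanged like
    ordinary sums. *)
HB.instance Definition _ := Monoid.isComLaw.Build (zser q A) (zser0 q A) fadd
  faddA faddC fadd0.

(** Since the partial derivative of F in its second variable is 1 at the origin, agreement of b and
    c below degree d makes F(a,b) - F(a,c) equal to b - c below degree d + 1; induction on d
    concludes. *)
Lemma fadd_cancel d a b c :
  sord d (val (fadd a b) - val (fadd a c)) -> sord d (val b - val c).
Proof.
elim: d => [|d IHd] od; first by move=> m.
have [->|d_gt0] := posnP d; first exact: sordB.
have dbc : sord d (val b - val c) by apply: IHd; apply: sord_le od.
have := sord_scomp2_diff F d_gt0 (sord_zser a) (sord_zser b) (sord_zser a)
  (sord_zser c) (@sord_refl _ _ _ _) dbc.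
rewrite subrr mulr0 add0r fgl_coefU1 rmorph1 mul1r => odd.
by rewrite -(subKr (val (fadd a b) - val (fadd a c)) (val b - val c)); apply: sordB.
Qed.

Lemma fadd_congr d a a' b b' : sord d (val a - val a') -> sord d (val b - val b') ->
  sord d (val (fadd a b) - val (fadd a' b')).
Proof.
by move=> da db; apply: sord_subscompr => i; case: ifP.
Qed.

Lemma fsum_congr d (I : Type) (r : seq I) (P : pred I) (c c' : I -> zser q A) :
  (forall i, P i -> sord d (val (c i) - val (c' i))) ->
  sord d (val (\big[fadd/zser0 q A]_(i <- r | P i) c i) -
          val (\big[fadd/zser0 q A]_(i <- r | P i) c' i)).
Proof.
move=> cc'; elim/big_rec2: _ => // i x y Pi dxy.
by apply: fadd_congr => //; apply: cc'.
Qed.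

Lemma fadd_lead d a b : (0 < d)%N -> sord d (val a) -> sord d (val b) ->
  sord d.+1 (val (fadd a b) - (val a + val b)).
Proof.
move=> d_gt0 oa ob.
have := @sord_scomp2_diff A q d F (val a) 0 (val b) 0 d_gt0.
rewrite scomp_F00 !subr0 fgl_coefU0 fgl_coefU1 rmorph1 !mul1r.
by apply.
Qed.

Lemma fsum_lead d (I : Type) (r : seq I) (P : pred I) (c : I -> zser q A) :
  (0 < d)%N -> (forall i, P i -> sord d (val (c i))) ->
  sord d (val (\big[fadd/zser0 q A]_(i <- r | P i) c i)) /\
  sord d.+1 (val (\big[fadd/zser0 q A]_(i <- r | P i) c i) -
             \sum_(i <- r | P i) val (c i)).
Proof.
move=> d_gt0 oc; elim/big_rec2: _ => [|i x y Pi [oy oyx]]; first by split.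
have oi := oc i Pi.
have oiy := fadd_lead d_gt0 oi oy; split.
  rewrite -(subrK (val (c i) + val y) (val _)); apply: sordD; last exact: sordD.
  exact: sord_le oiy.
by apply: sord_trans oiy _; apply: sord_subD.
Qed.

End Arity.

Lemma fgl_psumE (c : nat -> mseries 1 A) n : (forall i, sord 1 (c i)) ->
  fgl_psum F c n = val (\big[@fadd 1/zser0 1 A]_(i < n) zs (c i)).
Proof.
move=> oc; elim: n => [|n IHn]; first by rewrite big_ord0.
by rewrite big_ord_recr val_fadd /= IHn val_zs.
Qed.

Lemma scomp_fsum q r (g : 'I_q -> mseries r A) (I : Type) (s : seq I) (P : pred I)
    (c : I -> zser q A) : (forall i, sord 1 (g i)) ->
  scomp (val (\big[@fadd q/zser0 q A]_(i <- s | P i) c i)) g =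
  val (\big[@fadd r/zser0 r A]_(i <- s | P i) zs (scomp (val (c i)) g)).
Proof.
move=> og; elim/big_rec2: _ => [|i x y Pi IH]; first exact: scomp0.
have oz (z : zser q A) : sord 1 (scomp (val z) g) by apply: sord_scomp.
by rewrite !val_fadd scomp2_scomp // IH val_zs.
Qed.

End FormalGroup.

Arguments fadd {A F} HF {q} a b.

(** * The ring of p-typical formal group laws *)

Definition vmon (K : comNzRingType) (m : {cmonom nat}) : vpoly K := << m >>.
Definition vcst (K : comNzRingType) (c : K) : vpoly K := << c *g mone >>.

Lemma vmonM (K : comNzRingType) (m1 m2 : {cmonom nat}) :
  vmon K (mmul m1 m2) = vmon K m1 * vmon K m2.
Proof. by rewrite /vmon malgM_def fgmulUU mulr1. Qed.

Lemma vmon1 (K : comNzRingType) : vmon K mone = 1.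
Proof. exact: monalg.mpolyC1E. Qed.

Lemma vpolyE (K : comNzRingType) (x : vpoly K) :
  x = \sum_(m <- monalg.msupp x) vcst (monalg.mcoeff m x) * vmon K m.
Proof.
rewrite {1}[x]monalgE; apply: eq_bigr => m _.
by rewrite /vcst /vmon malgM_def fgmulUU mul1m mulr1.
Qed.

Opaque vmon vcst.

Section MorphismEq.
Context (K B : comNzRingType) (f1 f2 : {rmorphism vpoly K -> B}).

Lemma vpoly_morph_eq :
  (forall c, f1 (vcst c) = f2 (vcst c)) ->
  (forall i, f1 (vmon K (ucm i)) = f2 (vmon K (ucm i))) -> f1 =1 f2.
Proof.
move=> eqC eqV x.
have eqfM a b : f1 a = f2 a -> f1 b = f2 b -> f1 (a * b) = f2 (a * b).
  by rewrite !rmorphM => -> ->.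
have eqM d (m : {cmonom nat}) : (monalg.mdeg m < d)%N ->
    f1 (vmon K m) = f2 (vmon K m).
  elim: d m => // d IHd m lt_md.
  have [m0|m_neq0] := eqVneq (monalg.mdeg m) 0%N.
    by rewrite (mdeg_eq0I m0) vmon1 !rmorph1.
  have [i mi_gt0] : exists i, (0 < m i)%N.
    have : finsupp m != fset0.
      by apply: contraNneq m_neq0 => m0; rewrite monalg.mdegE m0 big_seq_fset0.
    by case/fset0Pn => i; rewrite -cmE_neq0 -lt0n; exists i.
  pose q := divcm m (ucm i).
  have def_m : m = mmul (ucm i) q.
    apply/eqP/cmP => j; rewrite cmM cmU divcmE cmU.
    by case: (eqVneq i j) => [<-|_]; rewrite ?subn0 // subnKC.
  have lt_qd : (monalg.mdeg q < d)%N.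
    by move: lt_md; rewrite {1}def_m monalg.mdegM monalg.mdegU.
  rewrite def_m vmonM.
  apply: eqfM.
    exact: eqV.
  exact: IHd.
rewrite [x]vpolyE !rmorph_sum; apply: eq_bigr => m _.
apply: eqfM.
  exact: eqC.
exact: eqM (ltnSn _).
Qed.

End MorphismEq.

(* The endomorphism killing v_1, ..., v_r, which are the variables of index   *)
(* < r, and fixing the other generators.                                      *)
Section Kill.
Context (K : comNzRingType) (r : nat).

Definition vkill_var (i : nat) : vpoly K := if (i < r)%N then 0 else vmon K (ucm i).

Definition vkill : {rmorphism vpoly K -> vpoly K} :=
  monalg.mmap (@mkmalgU {cmonom nat} K mone : {rmorphism K -> vpoly K}) (mon_eval vkill_var).

Lemma vkill_cst c : vkill (vcst c) = vcst c.
Proof. by rewrite /vkill /= monalg.mmapU mmorph1 mulr1. Qed.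

Lemma vkill_vmon i : vkill (vmon K (ucm i)) = vkill_var i.
Proof.
rewrite /vkill /= monalg.mmapU /= /mon_eval mdomU big_seq_fset1 cmUU expr1.
by rewrite [mkmalgU _ _]monalg.mpolyC1E mul1r.
Qed.

Lemma vkill_morph (B : comNzRingType) (f : {rmorphism vpoly K -> B}) :
  (forall i, (i < r)%N -> f (vmon K (ucm i)) = 0) -> forall x, f (vkill x) = f x.
Proof.
move=> f0; pose f' : {rmorphism vpoly K -> B} := f \o vkill.
apply: (@vpoly_morph_eq _ _ f') => [c|i] /=; first by rewrite vkill_cst.
by rewrite vkill_vmon /vkill_var; case: ifP => [/f0->|//]; rewrite rmorph0.
Qed.

End Kill.

Section Rational.
Context (p : nat).
Notation V := (vpoly (zloc p)).

Lemma mcoeff_vrat m (f : V) : monalg.mcoeff m (vrat f) = val (monalg.mcoeff m f).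
Proof.
rewrite /vrat raddf_sum /= (eq_bigr (fun k => val (monalg.mcoeff k f) *+ (k == m))).
  case: (boolP (m \in monalg.msupp f)) => [m_in|m_out].
    rewrite (big_fsetD1 m) //= eqxx big1_seq ?addr0 //.
    by move=> k /andP[_]; rewrite in_fsetD1 => /andP[/negPf -> _].
  rewrite big1_seq => [|k /andP[_ k_in]]; last first.
    by case: eqP => // km; rewrite km (negPf m_out) in k_in.
  by rewrite monalg.mcoeff_outdom.
by move=> k _; rewrite monalg.mcoeffU.
Qed.

Lemma vrat_is_zmod_morphism : zmod_morphism (@vrat p).
Proof.
move=> f g; apply/malgP => m; apply: etrans (mcoeff_vrat m (f - g)) _.
apply: etrans _ (esym (monalg.mcoeffB m (vrat f) (vrat g))).
apply: etrans _ (esym (congr2 (fun a b : rat => a - b) (mcoeff_vrat m f) (mcoeff_vrat m g))).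
by apply: (congr1 (@zloc_val p) (monalg.mcoeffB m f g)).
Qed.

Lemma msupp_vrat (f : V) : (monalg.msupp (vrat f) `<=` monalg.msupp f)%fset.
Proof.
apply/fsubsetP => m; rewrite -!monalg.mcoeff_neq0 mcoeff_vrat.
by apply: contraNneq => ->.
Qed.

Lemma vrat_is_monoid_morphism : monoid_morphism (@vrat p).
Proof.
split=> [|f g]; apply/malgP => m.
  by rewrite mcoeff_vrat !monalg.mcoeff1; case: eqP.
rewrite mcoeff_vrat (monalg.mcoeffMlw _ (msupp_vrat f) (msupp_vrat g)).
rewrite (monalg.mcoeffMlw _ (fsubset_refl _) (fsubset_refl _)) raddf_sum.
apply: eq_bigr => i _; rewrite raddf_sum; apply: eq_bigr => j _.
rewrite raddfMn; congr (_ *+ _).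
apply: etrans (rmorphM (\val : {rmorphism zloc p -> rat}) _ _) _.
by apply: (congr2 *%R (esym (mcoeff_vrat i f)) (esym (mcoeff_vrat j g))).
Qed.

HB.instance Definition _ := GRing.isZmodMorphism.Build V (vpoly rat)
  (@vrat p) vrat_is_zmod_morphism.
HB.instance Definition _ := GRing.isMonoidMorphism.Build V (vpoly rat)
  (@vrat p) vrat_is_monoid_morphism.

Lemma vrat_eq0 (f : V) : vrat f = 0 -> f = 0.
Proof.
move=> f0; apply/malgP => m; apply: val_inj.
by rewrite -mcoeff_vrat f0 !monalg.mcoeff0.
Qed.

Lemma vrat_cst (c : zloc p) : vrat (vcst c) = vcst (val c).
Proof.
by apply/malgP => m; rewrite mcoeff_vrat !monalg.mcoeffU; case: eqP.
Qed.

Lemma vrat_vmon i : @vrat p (vmon (zloc p) (ucm i)) = vmon rat (ucm i).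
Proof.
by apply/malgP => m; rewrite mcoeff_vrat !monalg.mcoeffU; case: eqP.
Qed.

Lemma vrat_araki i : vrat (araki_v (zloc p) p i) = araki_v rat p i.
Proof. by case: i => [|i] /=; [rewrite rmorph_nat | apply: vrat_vmon]. Qed.

Lemma vrat_kill r (f : V) : vrat (vkill (zloc p) r f) = vkill rat r (vrat f).
Proof.
pose f1 : {rmorphism V -> vpoly rat} := @vrat p \o vkill (zloc p) r.
pose f2 : {rmorphism V -> vpoly rat} := vkill rat r \o @vrat p.
apply: (@vpoly_morph_eq _ _ f1 f2) => [c|i] /=.
  by rewrite vkill_cst vrat_cst vkill_cst.
rewrite vkill_vmon vrat_vmon vkill_vmon /vkill_var.
by case: ifP => _; rewrite ?vrat_vmon // rmorph0.
Qed.

Lemma vpolyQ_torsionfree (m : nat) (x : vpoly rat) :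
  (0 < m)%N -> m%:R * x = 0 -> x = 0.
Proof.
move=> m_gt0; rewrite mulr_natl => mx0; apply/malgP => k.
have := congr1 (monalg.mcoeff k) mx0; rewrite raddfMn raddf0 => /eqP.
by rewrite mulrn_eq0 gtn_eqF // => /eqP.
Qed.

End Rational.

(** * Logarithms *)

Section Binomial.
Context (p : nat) (pr_p : prime p).

(** From i C(q,i) = q C(q-1,i-1) with q = p^m: if p did not divide C(q,i), then q would divide i. *)
Lemma pfactor_dvd_bin m i : (0 < i < p ^ m)%N -> (p %| 'C(p ^ m, i))%N.
Proof.
case/andP=> i_gt0 lt_iq; apply: contraLR (lt_iq) => p_ndvd; rewrite -leqNgt.
apply: dvdn_leq => //; rewrite -(@Gauss_dvdl _ _ 'C(p ^ m, i)).
  rewrite -(prednK i_gt0) -mul_bin_diag.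
  by apply: dvdn_mulr.
by rewrite coprimeXl // prime_coprime.
Qed.

(* ((x + y)^q - x^q - y^q) / p *)
Definition binsum (B : comNzRingType) (q : nat) (x y : B) : B :=
  \sum_(1 <= i < q) ('C(q, i) %/ p)%:R * x ^+ (q - i) * y ^+ i.

Lemma exprD_binsum (B : comNzRingType) m (x y : B) : (0 < m)%N ->
  (x + y) ^+ (p ^ m) = x ^+ (p ^ m) + y ^+ (p ^ m) + p%:R * binsum (p ^ m) x y.
Proof.
move=> m_gt0; have q_gt0 : (0 < p ^ m)%N by rewrite expn_gt0 prime_gt0.
rewrite exprDn -(big_mkord predT (fun i => x ^+ (p ^ m - i) * y ^+ i *+ 'C(p ^ m, i))).
rewrite big_nat_recr // big_ltn //= bin0 subn0 expr0 mulr1 mulr1n.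
rewrite subnn expr0 mul1r binn mulr1n -addrA -[RHS]addrA; congr (_ + _).
rewrite addrC; congr (_ + _); rewrite /binsum mulr_sumr.
rewrite [LHS]big_nat_cond [RHS]big_nat_cond; apply: eq_bigr => i /andP[lt_i _].
rewrite -mulr_natl -{1}(divnK (pfactor_dvd_bin lt_i)) mulnC natrM.
by rewrite !mulrA.
Qed.

Lemma binsum_rmorph (B C : comNzRingType) (f : {rmorphism B -> C}) q x y :
  f (binsum q x y) = binsum q (f x) (f y).
Proof.
rewrite /binsum rmorph_sum; apply: eq_bigr => i _.
by rewrite !rmorphM rmorph_nat !rmorphXn.
Qed.

(** Modulo p, (x+y)^(p^m) is x^(p^m) + y^(p^m). Taking p-th powers improves this to a congruence
    modulo p^2; expanding both sides and cancelling one factor p leaves the claim. *)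
Lemma divides_binsum (R : comNzRingType) m (x y : R) :
    (forall a : R, p%:R * a = 0 -> a = 0) ->
  divides p%:R (binsum (p ^ m.+1) x y - binsum p (x ^+ (p ^ m)) (y ^+ (p ^ m))).
Proof.
move=> tf; have [r E] : divides (p ^ 2)%:R
    ((x + y) ^+ (p ^ m.+1) - (x ^+ (p ^ m) + y ^+ (p ^ m)) ^+ p).
  rewrite (expnSr p m) exprM; apply: divides_exprB => //; rewrite expn1.
  elim: m => [|m [s IHm]]; first by rewrite expn0 !expr1 subrr; exists 0; rewrite mulr0.
  have [t Et] := divides_exprD pr_p (x ^+ (p ^ m)) (y ^+ (p ^ m)).
  have : divides (p ^ 1)%:R ((x + y) ^+ (p ^ m) - (x ^+ (p ^ m) + y ^+ (p ^ m))).
    by exists s; rewrite expn1.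
  move=> /divides_exprB [w Ew]; exists (p%:R * w + t).
  by rewrite mulrDr mulrA -natrM mulnn -Ew -Et !expnSr !exprM addrA subrK.
exists r; apply/eqP; rewrite -subr_eq0; apply/eqP/tf.
have Ep := exprD_binsum (x ^+ (p ^ m)) (y ^+ (p ^ m)) (ltn0Sn 0).
rewrite expn1 in Ep; move: E; rewrite exprD_binsum // Ep -!exprM -!expnSr.
set s := binsum _ _ _; set t := binsum _ _ _; set u := x ^+ _; set w := y ^+ _.
rewrite opprD addrACA subrr add0r -mulrBr natrX expr2 -mulrA => /eqP.
by rewrite -subr_eq0 -mulrBr => /eqP.
Qed.

(** In B itself p cannot be cancelled, so the congruence is taken in a polynomial ring over the
    integers in two variables, which is torsion free, and then specialized to x and y. *)
Lemma binsum_pchar (B : comNzRingType) m (x y : B) : p%:R = 0 :> B ->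
  binsum (p ^ m.+1) x y = binsum p (x ^+ (p ^ m)) (y ^+ (p ^ m)).
Proof.
move=> p0; pose c (b : bool) := if b then x else y.
have gen (R : comNzRingType) (f : {rmorphism R -> B}) (X Y : R) :
    (forall a : R, p%:R * a = 0 -> a = 0) ->
    binsum (p ^ m.+1) (f X) (f Y) = binsum p (f X ^+ (p ^ m)) (f Y ^+ (p ^ m)).
  case/(divides_binsum m X Y) => r /(congr1 f)/eqP.
  rewrite rmorphM rmorph_nat p0 mul0r rmorphB subr_eq0 => /eqP.
  by rewrite !binsum_rmorph !rmorphXn.
have ex : zeval c (zvar true) = x := zeval_var c true.
have ey : zeval c (zvar false) = y := zeval_var c false.
rewrite -ex -ey; apply: gen => a.
exact/zpoly_torsionfree/prime_gt0.
Qed.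

End Binomial.

Lemma sum_triangle (V : nmodType) (X : nat -> nat -> V) M :
  \sum_(0 <= n < M) \sum_(0 <= i < n.+1) X i (n - i)%N =
  \sum_(0 <= i < M) \sum_(0 <= j < M - i) X i j.
Proof.
elim: M => [|M IHM]; first by rewrite !big_geq.
rewrite big_nat_recr // IHM.
transitivity (\sum_(0 <= i < M.+1) (\sum_(0 <= j < M - i) X i j + X i (M - i)%N)).
  rewrite big_split /= [X in _ = X + _]big_nat_recr //= subnn.
  by rewrite [\sum_(0 <= j < 0) _]big_geq // addr0.
by apply: eq_big_nat => i /andP[_]; rewrite ltnS => le_iM; rewrite subSn // big_nat_recr.
Qed.

Section Logarithm.
Context (B : comNzRingType) (F : mseries 2 B) (HF : is_fgl F).
Context (p : nat) (pr_p : prime p) (l : nat -> B) (l0 : l 0%N = 1).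

Let L := plog_series p l.
Hypothesis LF : scomp1 L F = scomp1 L sx2 + scomp1 L sy2.

Notation "\fsum_ ( i < n ) E" := (\big[fadd HF/zser0 _ B]_(i < n) E)
  (at level 36, E at level 36, i, n at level 50).

Let p_gt1 := prime_gt1 pr_p.

Lemma plog_trunc M : sord (p ^ M) (L - \sum_(i < M) sconst (l i) * sx ^+ (p ^ i)).
Proof.
apply: sord_mon1 => k lt_k; rewrite scoefB scoef_sum.
have -> : L (mon1 k) = \sum_(i < k.+1 | (p ^ i == k)%N) l i.
  by rewrite /L /= mdeg_mon1.
apply/eqP; rewrite subr_eq0; apply/eqP.
rewrite (big_ord_widen_cond (maxn M k.+1) (fun i => p ^ i == k)%N l) ?leq_maxr //.
have -> : \sum_(i < M) (sconst (l i) * sx ^+ (p ^ i)) (mon1 k) =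
    \sum_(i < M | (p ^ i == k)%N) l i.
  by rewrite [RHS]big_mkcond; apply: eq_bigr => i _; rewrite scoef_monomial eq_sym; case: eqP.
rewrite (big_ord_widen_cond (maxn M k.+1) (fun i => p ^ i == k)%N l) ?leq_maxl //.
apply: eq_bigl => -[i /= _]; case: eqP => //= E.
have le_ik : (i <= k)%N by rewrite -E ltnW // ltn_expl.
by rewrite ltnS le_ik; move: lt_k; rewrite -E ltn_exp2l // => ->.
Qed.

Lemma scomp1_plog q M (a : mseries q B) : sord 1 a ->
  sord (p ^ M) (scomp1 L a - \sum_(i < M) sconst (l i) * a ^+ (p ^ i)).
Proof.
move=> oa; have := sord_subscomp (fun _ : 'I_1 => oa) (@plog_trunc M).
rewrite scomp_sum.
rewrite [\sum_(i < M) scomp _ _](eq_bigr (fun i : 'I_M => sconst (l i) * a ^+ (p ^ i))) // => i _.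
by rewrite scompM // scomp_sconst // scompX // scomp_svar.
Qed.

Lemma plogD q (a b : zser q B) :
  scomp1 L (val (fadd HF a b)) = scomp1 L (val a) + scomp1 L (val b).
Proof.
pose g (i : 'I_2) := if i == ord0 then val a else val b.
have og i : sord 1 (g i) by apply: sord_if.
have oF : sord 1 F by apply/sord1P; rewrite (fgl_coef0 HF).
have := congr1 (fun s : mseries 2 B => scomp s g) LF.
rewrite scompD /scomp1 !scompA // => E.
rewrite [LHS](_ : _ = scomp L (fun=> scomp F g)) // E.
by congr (_ + _); apply: eq_scomp => i; rewrite scomp_svar.
Qed.

Lemma plog0 q : scomp1 L 0 = 0 :> mseries q B.
Proof.
have := plogD (zser0 q B) (zser0 q B); rewrite fadd0 => /eqP.
by rewrite -subr_eq0 opprD addrA subrr sub0r oppr_eq0 => /eqP.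
Qed.

Lemma plog_fsum q (I : Type) (r : seq I) (P : pred I) (c : I -> zser q B) :
  scomp1 L (val (\big[fadd HF/zser0 q B]_(i <- r | P i) c i)) =
  \sum_(i <- r | P i) scomp1 L (val (c i)).
Proof.
by elim/big_rec2: _ => [|i x y _ <-]; [apply: plog0 | apply: plogD].
Qed.

(** The logarithm has linear coefficient 1, so a difference of logarithms has the same lowest term
    as the difference of the arguments. *)
Lemma plog_inj q d (a b : zser q B) :
  sord d (scomp1 L (val a) - scomp1 L (val b)) -> sord d (val a - val b).
Proof.
elim: d => [|d IHd] od; first by move=> m.
have [->|d_gt0] := posnP d; first exact: sordB.
have dab : sord d (val a - val b) by apply: IHd; apply: sord_le od.
have := @sord_scomp_diff 1 q B (fun _ => val a) (fun _ => sord_zser a) d L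
  (fun _ => val b) (fun _ => sord_zser b) d_gt0 (fun _ => dab).
rewrite big_ord1; have -> : L U_(ord0)%MM = 1.
  rewrite /= mdeg1 big_mkcond big_ord_recl big_ord1 l0 expn0 eqxx.
  by rewrite (expn1 p) gtn_eqF // [LHS]addr0.
rewrite rmorph1 mul1r => odd.
rewrite -(subKr (scomp1 L (val a) - scomp1 L (val b)) (val a - val b)).
exact: sordB.
Qed.

(** Both logarithms agree: that of [p](x) is p log x = \sum_n p l_n x^(p^n), that of the formal sum
    is \sum_(i,j) l_i v_j^(p^i) x^(p^(i+j)), and collecting i + j = n gives the Araki recursion.
    Then the logarithm is cancelled. *)
Lemma plog_pseries (v : nat -> B) M :
  (forall n, p%:R * l n = \sum_(i < n.+1) l i * v (n - i)%N ^+ (p ^ i)) ->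
  sord (p ^ M) (val (\fsum_(i < p) zs (sx : mseries 1 B)) -
                val (\fsum_(j < M) zs (sconst (v j) * sx ^+ (p ^ j)))).
Proof.
move=> vE; apply: plog_inj; rewrite !plog_fsum sumr_const card_ord.
have oX j : sord 1 (sconst (v j) * sx ^+ (p ^ j) : mseries 1 B).
  by apply/sordMr/(sord_le (e := 1 * p ^ j)); [rewrite mul1n expn_gt0 prime_gt0 | apply: sordX].
pose X i j : mseries 1 B := sconst (l i * v j ^+ (p ^ i)) * sx ^+ (p ^ (i + j)).
have XE i j : X i j = sconst (l i) * (sconst (v j) * sx ^+ (p ^ j)) ^+ (p ^ i).
  by rewrite /X rmorphM rmorphXn exprMn -exprM -expnD addnC -mulrA.
apply: (@sord_trans _ _ _ _ (\sum_(0 <= i < M) \sum_(0 <= j < M - i) X i j)).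
  rewrite val_zs // -mulr_natl -(rmorph_nat (@sconst 1 B)).
  apply: sord_trans (sord_subM (sord_refl _) (@scomp1_plog _ M _ _)) _ => //.
  rewrite (_ : _ - _ = 0) //; apply/eqP; rewrite subr_eq0; apply/eqP.
  rewrite mulr_sumr (eq_bigr (fun n : 'I_M => \sum_(0 <= i < n.+1) X i (n - i)%N)).
    rewrite -(big_mkord predT (fun n => \sum_(0 <= i < n.+1) X i (n - i)%N)).
    exact: sum_triangle.
  move=> n _; rewrite mulrA -rmorphM vE rmorph_sum mulr_suml big_mkord.
  by apply: eq_bigr => i _; rewrite /X subnKC // -ltnS.
apply: sord_sym.
apply: sord_trans (_ : sord _ (_ - \sum_(j < M) \sum_(i < M) X i j)) _.
  rewrite -sumrB; apply: sord_sum => j _; rewrite val_zs //.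
  by under eq_bigr do rewrite XE; apply: scomp1_plog.
(* The square i, j < M exceeds the triangle i + j < M only by terms of order at least p^M. *)
rewrite exchange_big big_mkord -sumrB; apply: sord_sum => i _.
rewrite -(big_mkord predT (X i)) (@big_cat_nat _ _ _ (M - i)%N 0%N) ?leq_subr //=.
rewrite addrAC subrr add0r big_nat_cond; apply: sord_sum => j /andP[/andP[le_j _] _].
apply/sordMr/(sord_le (e := 1 * p ^ (i + j))); last exact: sordX.
by rewrite mul1n leq_exp2l // -leq_subLR.
Qed.

Section Lead.
Context (v : nat -> B) (m : nat).
Hypothesis vE : forall n, p%:R * l n = \sum_(i < n.+1) l i * v (n - i)%N ^+ (p ^ i).
Hypothesis m_gt0 : (0 < m)%N.
Hypothesis v0 : v 0%N = p%:R.
Hypothesis v_eq0 : forall i, (0 < i < m)%N -> v i = 0.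
Hypothesis torsionfree : forall n (x : B), (0 < n)%N -> n%:R * x = 0 -> x = 0.

Let diff_reg n (x : B) : (0 < n)%N -> (p%:R - p%:R ^+ (p ^ n)) * x = 0 -> x = 0.
Proof.
move=> n_gt0; have pn_gt0 : (0 < p ^ (p ^ n) - p)%N.
  by rewrite subn_gt0 -{1}[p]expn1 ltn_exp2l // -{1}(expn0 p) ltn_exp2l.
rewrite -opprB mulNr => /eqP; rewrite oppr_eq0 -natrX -natrB => [/eqP|].
  exact: torsionfree.
by rewrite ltnW // -subn_gt0.
Qed.

(** In the Araki recursion the term l_n v_0^(p^n) = l_n p^(p^n) moves to the left. The intermediate
    l_i with 0 < i < n vanish by induction, because p - p^(p^i) is a nonzero integer and v_i = 0. *)
Lemma plog_coefE n : (0 < n <= m)%N -> (p%:R - p%:R ^+ (p ^ n)) * l n = v n.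
Proof.
elim/ltn_ind: n => n IHn /andP[n_gt0 le_nm].
rewrite mulrBl vE big_ord_recr subnn v0 [l n * _]mulrC addrK.
rewrite -(prednK n_gt0) big_ord_recl /= subn0 prednK // l0 mul1r expn0 expr1.
rewrite big1 ?addr0 // => i _; rewrite /bump /= add1n.
have lt_in : (i.+1 < n)%N by rewrite -ltn_predRL.
have lt_im : (i.+1 < m)%N := leq_trans lt_in le_nm.
by rewrite (@diff_reg i.+1 (l i.+1)) ?mul0r // IHn ?v_eq0 //= ltnW.
Qed.

Lemma plog_coef_eq0 n : (0 < n < m)%N -> l n = 0.
Proof.
case/andP=> n_gt0 lt_nm; apply: (diff_reg n_gt0).
by rewrite plog_coefE ?v_eq0 ?n_gt0 // ltnW.
Qed.

(* Below degree q + 1 with q = p^m the logarithm is x + l_m x^q, and          *)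
(* (p - p^q) l_m = v_m.                                                       *)
Lemma fgl_lead :
  sord (p ^ m).+1 ((1 - p%:R ^+ (p ^ m).-1) * (F - (sx2 + sy2)) +
                   sconst (v m) * binsum p (p ^ m) sx2 sy2).
Proof.
set q := (p ^ m)%N; set x := sx2; set y := sy2.
have q_gt1 : (1 < q)%N by rewrite -(expn0 p) ltn_exp2l.
have [ox oy] : sord 1 x /\ sord 1 y by split; apply: sord_svar.
have oF : sord 1 F by apply/sord1P; rewrite (fgl_coef0 HF).
have trunc (a : mseries 2 B) : sord 1 a ->
    sord q.+1 (scomp1 L a - (a + sconst (l m) * a ^+ q)).
  move=> oa; have lt_q : (q < p ^ m.+1)%N by rewrite ltn_exp2l.
  have := sord_le lt_q (@scomp1_plog 2 m.+1 a oa).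
  rewrite big_ord_recr /= -/q; suff -> : \sum_(i < m) sconst (l i) * a ^+ (p ^ i) = a by [].
  rewrite -(prednK m_gt0) big_ord_recl /= l0 rmorph1 mul1r expn0 expr1.
  rewrite big1 ?addr0 // => i _.
  by rewrite plog_coef_eq0 ?rmorph0 ?mul0r //= -ltn_predRL ltn_ord.
have F2 : sord 2 (F - (x + y)).
  case: (HF) => _ _ comm _; rewrite -[F in F - _]comm [x + y]addrC.
  have := fadd_lead HF (ltn0Sn 0) (sord_zser (zs y)) (sord_zser (zs x)).
  by rewrite val_fadd !val_zs //.
have Fq : sord q.+1 (F ^+ q - (x + y) ^+ q).
  have oxy : sord 1 (x + y) by apply: sordD.
  by have := @sord_subX_lead _ _ 1 1 F (x + y) q oF oxy F2; rewrite mul1n addn1.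
pose s : mseries 2 B := sconst (l m).
have step : sord q.+1 (F - (x + y) + s * (p%:R * binsum p q x y)).
  have D : sord q.+1 (F + s * F ^+ q - ((x + s * x ^+ q) + (y + s * y ^+ q))).
    apply: sord_trans (sord_sym (trunc _ oF)) _; rewrite LF.
    by apply: sord_subD; apply: trunc.
  rewrite (_ : _ + _ = F + s * F ^+ q - ((x + s * x ^+ q) + (y + s * y ^+ q))
     - s * (F ^+ q - (x + y) ^+ q)); first by apply: sordB => //; apply: sordMr.
  rewrite [(x + y) ^+ q]exprD_binsum //; ring.
(* Multiplying by p - p^q turns l_m into v_m. The whole expression then has a factor p, which
   torsion-freeness removes. *)
have := sordMr (p%:R - p%:R ^+ q) step; rewrite mulrDr [in X in _ + X]mulrA.
have -> : (p%:R - p%:R ^+ q) * s = sconst (v m) :> mseries 2 B.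
  by rewrite -plog_coefE ?m_gt0 ?leqnn // rmorphM rmorphB rmorphXn !rmorph_nat.
move=> ow; have {}ow : sord q.+1 (sconst p%:R * ((1 - p%:R ^+ q.-1) * (F - (x + y)) +
                   sconst (v m) * binsum p q x y)).
  have Ep : p%:R - p%:R ^+ q = p%:R * (1 - p%:R ^+ q.-1) :> mseries 2 B.
    by rewrite mulrBr mulr1 -exprS prednK // ltnW.
  by rewrite rmorph_nat mulrDr (mulrA _ (1 - _)) -Ep mulrCA.
move=> e lt_e; apply: (torsionfree (prime_gt0 pr_p)).
by rewrite -sconst_mulE ow.
Qed.

End Lead.

End Logarithm.

(** * Base change of formal sums, and descent from V \otimes Q to V *)

Section Transport.
Context (A B : comNzRingType) (f : {rmorphism A -> B}).

Lemma smap_fsum (F : mseries 2 A) (HF : is_fgl F) (HF' : is_fgl (smap f F)) q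
    (I : Type) (r : seq I) (P : pred I) (c : I -> zser q A) :
  smap f (val (\big[fadd HF/zser0 q A]_(i <- r | P i) c i)) =
  val (\big[fadd HF'/zser0 q B]_(i <- r | P i) zs (smap f (val (c i)))).
Proof.
elim/big_rec2: _ => [|i x y Pi IH]; first exact: rmorph0.
have oz : sord 1 (smap f (val (c i))) by apply: sord_smap.
by rewrite !val_fadd smap_scomp2 IH val_zs.
Qed.

Lemma smap_plog p (l : nat -> A) :
  smap f (plog_series p l) = plog_series p (fun n => f (l n)).
Proof. by apply: seriesP => m /=; rewrite rmorph_sum. Qed.

Lemma smap_binsum n p q (x y : mseries n A) :
  smap f (binsum p q x y) = binsum p q (smap f x) (smap f y).
Proof. exact: binsum_rmorph. Qed.

Lemma araki_rmorph p (l v : nat -> A) :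
  (forall n, p%:R * l n = \sum_(i < n.+1) l i * v (n - i)%N ^+ (p ^ i)) ->
  forall n, p%:R * f (l n) = \sum_(i < n.+1) f (l i) * f (v (n - i)%N) ^+ (p ^ i).
Proof.
move=> vE n; rewrite -(rmorph_nat f) -rmorphM vE rmorph_sum.
by apply: eq_bigr => i _; rewrite rmorphM rmorphXn.
Qed.

Lemma smap_log (l : mseries 1 A) (F : mseries 2 A) :
  scomp1 l F = scomp1 l sx2 + scomp1 l sy2 ->
  scomp1 (smap f l) (smap f F) = scomp1 (smap f l) sx2 + scomp1 (smap f l) sy2.
Proof.
by move=> /(congr1 (smap f)); rewrite smapD !smap_scomp1 !smap_svar.
Qed.

(** The expression bounded in [fgl_lead]. It has no denominators, so its vanishing can be tested in
    V \otimes Q and then pushed to any V-algebra. *)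
Definition lead_defect p q (R : comNzRingType) (F : mseries 2 R) (w : R) :=
  (1 - p%:R ^+ q.-1) * (F - (sx2 + sy2)) + sconst w * binsum p q sx2 sy2.

Lemma smap_lead_defect p q F w :
  smap f (lead_defect p q F w) = lead_defect p q (smap f F) (f w).
Proof.
rewrite /lead_defect smapD !smapM !smapB smapD smapX smap_binsum smap_sconst !smap_svar.
by rewrite (rmorph1 (smap f)) (rmorph_nat (smap f)).
Qed.

End Transport.

Section Integral.
Context (V VQ : comNzRingType) (r : {rmorphism V -> VQ}).
Hypothesis r_inj : forall x, r x = 0 -> x = 0.
Context (p : nat) (pr_p : prime p) (G : mseries 2 V) (HG : is_fgl G).
Context (l : nat -> VQ) (v : nat -> V).
Hypothesis l0 : l 0%N = 1.
Hypothesis vE :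
  forall n, p%:R * l n = \sum_(i < n.+1) l i * r (v (n - i)%N) ^+ (p ^ i).
Hypothesis LG : let L := plog_series p l in
  scomp1 L (smap r G) = scomp1 L sx2 + scomp1 L sy2.

Lemma smap_sord_inj n d (s : mseries n V) : sord d (smap r s) -> sord d s.
Proof. by move=> os m lt_md; apply: r_inj; apply: os. Qed.

Lemma sord_monomial (R : comNzRingType) (c : R) q (a : zser q R) j :
  sord (p ^ j) (sconst c * val a ^+ (p ^ j)).
Proof. by apply: sordMr; rewrite -[X in sord X]mul1n; apply: sordX. Qed.

Let sord1_monomial (R : comNzRingType) (c : R) q (a : zser q R) j :
  sord 1 (sconst c * val a ^+ (p ^ j)).
Proof.
by apply: (@sord_le _ _ _ (p ^ j)); [rewrite expn_gt0 prime_gt0|apply: sord_monomial].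
Qed.

Let val_zsx (R : comNzRingType) : val (zs sx : zser 1 R) = sx.
Proof. exact/val_zs/sord_svar. Qed.

(** The logarithm exists over V \otimes Q only; the resulting identity has coefficients in V and
    descends because V embeds. *)
Lemma integral_pseries M :
  sord (p ^ M) (val (\big[fadd HG/zser0 1 V]_(i < p) zs sx) -
     val (\big[fadd HG/zser0 1 V]_(j < M) zs (sconst (v j) * val (zs sx : zser 1 V) ^+ (p ^ j)))).
Proof.
apply: smap_sord_inj; have HG' : is_fgl (smap r G) by apply: smap_fgl.
rewrite smapB !(smap_fsum HG HG').
under eq_bigr => i _ do rewrite val_zsx smap_svar.
under [\big[_/_]_(j < M) _]eq_bigr => j _ do
  rewrite val_zs // val_zsx smapM smapX smap_sconst smap_svar.
exact: (@plog_pseries _ _ HG' p pr_p l l0 LG (fun j => r (v j)) M vE).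
Qed.

Section Push.
Context (A : comNzRingType) (f : {rmorphism V -> A}) (HF : is_fgl (smap f G)).

Lemma pseries_push M q (a : zser q A) :
  sord (p ^ M) (val (\big[fadd HF/zser0 q A]_(i < p) a) -
     val (\big[fadd HF/zser0 q A]_(j < M) zs (sconst (f (v j)) * val a ^+ (p ^ j)))).
Proof.
have oa (i : 'I_1) : sord 1 (val a) by apply: sord_zser.
have H := sord_smap f (@integral_pseries M).
rewrite smapB !(smap_fsum HG HF) in H.
have := sord_subscomp oa H; rewrite !scomp_fsum // => {}H.
have E1 j : smap f (val (zs (sconst (v j) * val (zs sx : zser 1 V) ^+ (p ^ j)))) =
    sconst (f (v j)) * val (zs sx : zser 1 A) ^+ (p ^ j).
  by rewrite val_zs ?sord1_monomial // !val_zsx smapM smapX smap_sconst smap_svar.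
have E2 j : scomp (val (zs (sconst (f (v j)) * val (zs sx : zser 1 A) ^+ (p ^ j))))
    (fun _ => val a) = sconst (f (v j)) * val a ^+ (p ^ j).
  rewrite val_zs ?sord1_monomial // val_zsx.
  by rewrite scompM // scomp_sconst // scompX // scomp_svar.
have E3 (r1 r2 s1 s2 : zser q A) : r1 = s1 -> r2 = s2 ->
  sord (p ^ M) (val r1 - val r2) -> sord (p ^ M) (val s1 - val s2) by move=> -> ->.
apply: E3 H; apply: eq_bigr => j _; last by rewrite E1 E2.
by rewrite val_zsx smap_svar val_zsx scomp_svar // zs_val.
Qed.

(** [fgl_lead] needs both v_i = 0 for 0 < i < m and torsion-freeness, while A has characteristic p.
    So the generators are killed first, inside V and V \otimes Q, by [kV] and [kQ]; as f does not
    see [kV], the result maps to A. *)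
Lemma lead_push (kV : {rmorphism V -> V}) (kQ : {rmorphism VQ -> VQ}) m :
    (0 < m)%N -> p%:R = 0 :> A -> v 0%N = p%:R ->
    (forall x, r (kV x) = kQ (r x)) -> (forall x, f (kV x) = f x) ->
    (forall i, (0 < i < m)%N -> kV (v i) = 0) ->
    (forall n (x : VQ), (0 < n)%N -> n%:R * x = 0 -> x = 0) ->
  sord (p ^ m).+1 (smap f G - (sx2 + sy2) +
    sconst (f (v m)) * binsum p (p ^ m) sx2 sy2).
Proof.
move=> m_gt0 p0 v0 rk fk k0 tf.
have smapC (B C D E : comNzRingType) (f1 : {rmorphism B -> C}) (f2 : {rmorphism C -> E})
    (f3 : {rmorphism B -> D}) (f4 : {rmorphism D -> E}) (s : mseries 2 B) :
  (forall x, f2 (f1 x) = f4 (f3 x)) -> smap f2 (smap f1 s) = smap f4 (smap f3 s).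
- by move=> E12; apply: seriesP => e /=.
have lead : sord (p ^ m).+1 (lead_defect p (p ^ m) (smap kV G) (kV (v m))).
  apply: smap_sord_inj; rewrite smap_lead_defect rk.
  rewrite (smapC _ _ _ _ kV r r kQ) //.
  have HG' : is_fgl (smap kQ (smap r G)) by do 2!apply: smap_fgl.
  have := smap_log kQ LG; rewrite smap_plog => LG'.
  apply: (@fgl_lead _ _ HG' p pr_p _ _ LG' (fun i => kQ (r (v i)))) => //.
  - by rewrite l0 rmorph1.
  - exact: (araki_rmorph kQ (v := fun i => r (v i)) vE).
  - by rewrite v0 !rmorph_nat.
  - by move=> i lt_i; rewrite -rk k0 // rmorph0.
have := sord_smap f lead; rewrite smap_lead_defect fk.
have -> : smap f (smap kV G) = smap f G by apply: seriesP => e /=.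
rewrite /lead_defect -(rmorph_nat (@sconst 2 A)) p0 rmorph0 expr0n.
(* The factor 1 - p^(q-1) becomes 1 in A because q > 1, so that the power of p is not p^0. *)
suff -> : ((p ^ m).-1 == 0)%N = false by rewrite subr0 mul1r.
have q_gt1 : (1 < p ^ m)%N by rewrite -(expn0 p) ltn_exp2l // prime_gt1.
by rewrite gtn_eqF // ltn_predRL.
Qed.

End Push.
End Integral.

(* The polynomial rings with a fixed ring structure, which spares the         *)
(* unifier from comparing the many paths to it.                               *)
Definition vring (K : comNzRingType) : comNzRingType := vpoly K.

(** * The universal p-typical law and its specializations *)

Section Universal.
Context (p : nat) (pr_p : prime p).
Notation V := (vring (zloc p)).
Notation VQ := (vring rat).

Definition vringQ : {rmorphism V -> VQ} := @vrat p.
Definition araki : nat -> V := araki_v (zloc p) p.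
Definition vkillZ (r : nat) : {rmorphism V -> V} := vkill (zloc p) r.
Definition vkillQ (r : nat) : {rmorphism VQ -> VQ} := vkill rat r.

Lemma vringQ_inj x : vringQ x = 0 -> x = 0.
Proof. exact: vrat_eq0. Qed.

Lemma vringQ_kill r x : vringQ (vkillZ r x) = vkillQ r (vringQ x).
Proof. exact: vrat_kill. Qed.

Lemma vkillZ_araki r i : (0 < i <= r)%N -> vkillZ r (araki i) = 0.
Proof.
case: i => // i /andP[_ lt_ir]; apply: etrans (vkill_vmon _ _ _) _.
by rewrite /vkill_var lt_ir.
Qed.

Lemma vkillZ_morph (B : comNzRingType) (f : {rmorphism V -> B}) r :
  (forall i, (0 < i <= r)%N -> f (araki i) = 0) -> forall x, f (vkillZ r x) = f x.
Proof.
by move=> f0; apply: (@vkill_morph _ r B f) => i lt_ir; apply: (f0 i.+1).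
Qed.

Lemma vringQ_torsionfree n (x : VQ) : (0 < n)%N -> n%:R * x = 0 -> x = 0.
Proof. exact: vpolyQ_torsionfree. Qed.

Lemma universal_ptypicalE (G : mseries 2 V) : universal_ptypical G ->
  exists l : nat -> VQ,
  [/\ is_fgl G, l 0%N = 1,
      forall n, p%:R * l n = \sum_(i < n.+1) l i * vringQ (araki (n - i)) ^+ (p ^ i) &
      let L := plog_series p l in scomp1 L (smap vringQ G) = scomp1 L sx2 + scomp1 L sy2].
Proof.
case=> HG [l [l0 lE] LG]; exists l.
split; [exact: HG | exact: l0 | | exact: LG].
pose P (w : nat -> VQ) :=
  forall n, p%:R * (l n : VQ) = \sum_(i < n.+1) (l i : VQ) * w (n - i)%N ^+ (p ^ i).
suff : P (fun i => vringQ (araki i)) by [].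
have -> : (fun i => vringQ (araki i)) = araki_v rat p.
  by apply: funext; exact: vrat_araki.
exact: lE.
Qed.

Context (G : mseries 2 V) (G_univ : universal_ptypical G).
Context (A : comNzRingType) (f : {rmorphism V -> A}) (HF : is_fgl (smap f G)).

Lemma ptypical_pseries M q (a : zser q A) :
  sord (p ^ M) (val (\big[fadd HF/zser0 q A]_(i < p) a) -
     val (\big[fadd HF/zser0 q A]_(j < M)
       zs (sconst (f (araki j)) * val a ^+ (p ^ j)))).
Proof.
have [l [HG l0 lE LG]] := universal_ptypicalE G_univ.
exact: (pseries_push vringQ_inj pr_p HG l0 lE LG HF).
Qed.

Lemma ptypical_lead m : (0 < m)%N -> p%:R = 0 :> A ->
    (forall i, (0 < i < m)%N -> f (araki i) = 0) ->
  sord (p ^ m).+1 (smap f G - (sx2 + sy2) +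
    sconst (f (araki m)) * binsum p (p ^ m) sx2 sy2).
Proof.
move=> m_gt0 p0 f0; have [l [HG l0 lE LG]] := universal_ptypicalE G_univ.
have le_m i : (i <= m.-1)%N = (i < m)%N by rewrite -{2}(prednK m_gt0) ltnS.
apply: (lead_push vringQ_inj pr_p HG l0 lE LG m_gt0 p0 _ (vringQ_kill m.-1)).
- by [].
- by apply: vkillZ_morph => i; rewrite le_m; apply: f0.
- by move=> i lt_i; apply: vkillZ_araki; rewrite le_m.
- exact: vringQ_torsionfree.
Qed.

End Universal.

(** * Leading terms in characteristic p *)

Lemma binsumMr (R : comNzRingType) p q (x y z : R) :
  binsum p q (x * z) (y * z) = binsum p q x y * z ^+ q.
Proof.
rewrite /binsum mulr_suml; apply: eq_big_nat => i /andP[_ /ltnW le_iq].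
have -> : z ^+ q = z ^+ (q - i) * z ^+ i by rewrite -exprD subnK.
by rewrite !exprMn [_ * (x ^+ _ * _)]mulrA mulrACA.
Qed.

Lemma binsumx0 (R : comNzRingType) p q (x : R) : binsum p q x 0 = 0.
Proof.
rewrite /binsum big_nat big1 // => i /andP[i_gt0 _].
by rewrite expr0n gtn_eqF // mulr0.
Qed.

Lemma scomp_binsum (R : comNzRingType) p q n k (g : 'I_n -> mseries k R)
    (x y : mseries n R) : (forall i, sord 1 (g i)) ->
  scomp (binsum p q x y) g = binsum p q (scomp x g) (scomp y g).
Proof.
move=> og; rewrite /binsum scomp_sum; apply: eq_bigr => i _.
rewrite !scompM // !scompX // -(rmorph_nat (@sconst n R)) scomp_sconst //.
by rewrite rmorph_nat.
Qed.

Section LeadingCoefficient.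
Context (A : comNzRingType).

Lemma sord_lead_term d (a : mseries 1 A) : sord d a ->
  sord (d + 1) (a - sconst (a (mon1 d)) * sx ^+ d).
Proof.
move=> oa; apply: sord_mon1 => k; rewrite addn1 ltnS leq_eqVlt scoefB scoef_monomial.
by case/orP=> [/eqP->|lt_kd]; [rewrite eqxx subrr|
  rewrite oa ?mdeg_mon1 // ltn_eqF // subrr].
Qed.

(** [binsum p q] is homogeneous of degree q, so in degree dq only the leading terms of a and b
    matter. *)
Lemma scoef_binsum p q d (a b : mseries 1 A) : sord d a -> sord d b ->
  (binsum p q a b) (mon1 (d * q)) = binsum p q (a (mon1 d)) (b (mon1 d)).
Proof.
move=> oa ob; pose c (s : mseries 1 A) := sconst (s (mon1 d)) * sx ^+ d.
have oX (s : A) : sord d (sconst s * sx ^+ d : mseries 1 A).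
  by apply: sordMr; rewrite -[X in sord X]mul1n; apply/sordX/sord_svar.
have E : binsum p q (c a) (c b) =
    sconst (binsum p q (a (mon1 d)) (b (mon1 d))) * sx ^+ (d * q).
  by rewrite binsumMr exprM (binsum_rmorph p (@sconst 1 A)).
have := scoef_monomial (binsum p q (a (mon1 d)) (b (mon1 d))) (d * q) (d * q).
rewrite eqxx mulr1n -E => <-.
apply: (@sord_coef _ _ (d * q + 1)); last by rewrite mdeg_mon1 addn1.
rewrite /binsum -sumrB big_nat; apply: sord_sum => i /andP[_ /ltnW le_iq].
rewrite -!mulrA -mulrBr; apply: sordMr.
rewrite -[in (d * q)%N](subnK le_iq) mulnDr.
apply: sord_subM_lead; [exact/sordX/oX | exact/sordX/ob | |].
  by apply: sord_subX_lead; [| apply: oX | apply: sord_lead_term].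
by apply: sord_subX_lead; [| apply: oX | apply: sord_lead_term].
Qed.

End LeadingCoefficient.

Section CharP.
Context (p : nat) (pr_p : prime p) (A : comNzRingType) (F : mseries 2 A).
Context (HF : is_fgl F) (m : nat) (m_gt0 : (0 < m)%N) (u : A).
Let q := (p ^ m)%N.
Let P := (p ^ m.+1)%N.
Hypothesis F_lead : sord q.+1 (F - (sx2 + sy2) + sconst u * binsum p q sx2 sy2).

Let p_gt0 : (0 < p)%N := prime_gt0 pr_p.
Let p_gt1 : (1 < p)%N := prime_gt1 pr_p.

(** Substituting series of order d into the error of [F_lead], which has order q + 1, gives order
    d(q+1) > dq. *)
Lemma scoef_fadd d (a b : zser 1 A) : (0 < d)%N -> sord d (val a) -> sord d (val b) ->
  val (fadd HF a b) (mon1 (d * q)) =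
  val a (mon1 (d * q)) + val b (mon1 (d * q)) -
  u * binsum p q (val a (mon1 d)) (val b (mon1 d)).
Proof.
move=> d_gt0 oa ob; pose g (i : 'I_2) := if i == ord0 then val a else val b.
have og i : sord 1 (g i) by apply: sord_if.
have dg i : sord d (g i) by apply: sord_if.
have := sord_scompM og d_gt0 dg F_lead.
rewrite scompD scompB scompD scompM // scomp_sconst // scomp_binsum // !scomp_svar //.
move/(_ (mon1 (d * q))); rewrite mdeg_mon1 ltn_pmul2l // => /(_ (ltnSn _))/eqP.
rewrite scoefD scoefB scoefD sconst_mulE scoef_binsum // addr_eq0 subr_eq.
by move/eqP; rewrite [RHS]addrC => <-.
Qed.

(** When every term starts above degree d, the correction of [scoef_fadd] is zero, and formal
    addition is ordinary addition in degree dq. *)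
Lemma scoef_fsum d (I : Type) (r : seq I) (Q : pred I) (c : I -> zser 1 A) :
  (forall i, Q i -> sord d.+1 (val (c i))) ->
  (0 < d)%N ->
  val (\big[fadd HF/zser0 1 A]_(i <- r | Q i) c i) (mon1 (d * q)) =
  \sum_(i <- r | Q i) val (c i) (mon1 (d * q)).
Proof.
move=> oc d_gt0.
suff [] : sord d.+1 (val (\big[fadd HF/zser0 1 A]_(i <- r | Q i) c i)) /\
  val (\big[fadd HF/zser0 1 A]_(i <- r | Q i) c i) (mon1 (d * q)) =
  \sum_(i <- r | Q i) val (c i) (mon1 (d * q)) by [].
split; first by case: (@fsum_lead A F HF 1 d.+1 I r Q c).
elim: r => [|i r IHr]; first by rewrite !big_nil scoef0.
rewrite !big_cons; case: ifP => // Qi; rewrite scoef_fadd //.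
- have [+ _] := @fsum_lead A F HF 1 d.+1 I r Q c isT oc.
  move/(_ (mon1 d)) => ->; last by rewrite mdeg_mon1.
  by rewrite binsumx0 mulr0 subr0 IHr.
- exact/sord_le/(oc i).
- by case: (@fsum_lead A F HF 1 d.+1 I r Q c isT oc) => + _; apply: sord_le.
Qed.

Definition zmon (c : A) k : zser 1 A := zs (sconst c * sx ^+ (p ^ k)).

Lemma val_zmon c k : val (zmon c k) = sconst c * sx ^+ (p ^ k).
Proof.
rewrite val_zs //; apply/sordMr/(@sord_le _ _ _ (1 * p ^ k)).
  by rewrite mul1n expn_gt0 p_gt0.
exact/sordX/sord_svar.
Qed.

Lemma zmon0 k : zmon 0 k = zser0 1 A.
Proof. by apply: val_inj; rewrite val_zmon rmorph0 mul0r. Qed.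

Lemma sord_zmon d c k : (d <= p ^ k)%N -> sord d (val (zmon c k)).
Proof.
move=> le_d; rewrite val_zmon; apply: (sord_le le_d); apply: sordMr.
by rewrite -[X in sord X]mul1n; apply/sordX/sord_svar.
Qed.

Lemma scoef_zmon c k j : val (zmon c k) (mon1 (p ^ j)) = c *+ (j == k).
Proof. by rewrite val_zmon scoef_monomial eqn_exp2l. Qed.

Context (N : nat) (lt_mN : (m.*2.+1 < N)%N).

(** Common shape of the two sides of the p-series identity, cut off at i, j < N. *)
Definition Fsum (X : nat -> nat -> A) : zser 1 A :=
  \big[fadd HF/zser0 1 A]_(ij : 'I_N * 'I_N) zmon (X ij.1 ij.2) (ij.1 + ij.2).

Lemma scoef_Fsum X k : (k < N)%N -> (forall i j, (j < k)%N -> X i j = 0) ->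
  val (Fsum X) (mon1 (p ^ k)) = X 0%N k.
Proof.
move=> lt_kN X0; have N_gt0 : (0 < N)%N by apply: leq_ltn_trans lt_kN.
have pk_gt0 : (0 < p ^ k)%N by rewrite expn_gt0 p_gt0.
have oX (ij : 'I_N * 'I_N) : sord (p ^ k) (val (zmon (X ij.1 ij.2) (ij.1 + ij.2))).
  have [lt_jk|le_kj] := ltnP ij.2 k; first by rewrite X0 // zmon0.
  by apply: sord_zmon; rewrite leq_exp2l // (leq_trans le_kj) // leq_addl.
have [_ oE] := @fsum_lead A F HF 1 (p ^ k) _ (index_enum ('I_N * 'I_N)%type) predT _
  pk_gt0 (fun ij _ => oX ij).
rewrite (sord_coef oE) ?mdeg_mon1 // scoef_sum (bigD1 (Ordinal N_gt0, Ordinal lt_kN)) //=.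
rewrite scoef_zmon add0n eqxx big1 ?addr0 // => -[i j] /= ne.
rewrite scoef_zmon; have [lt_jk|le_kj] := ltnP j k; first by rewrite X0 // mul0rn.
case: eqP => // Ek; case/eqP: ne.
have /eqP : (k + i)%N = k by apply/eqP; rewrite eqn_leq leq_addr andbT {2}Ek addnC leq_add2l.
rewrite -[X in _ == X]addn0 eqn_add2l => /eqP i0.
by congr (_, _); apply: val_inj => //=; rewrite Ek i0.
Qed.

(** Only j = m and j = m + 1 survive. Besides the split-off term of degree q, the terms (0, m+1) and
    (1, m) have degree P and produce the correction; all others start above P ([idx1]), and among
    them only (m+1, m) and (m, m+1) have degree Pq = p^(2m+1) ([idx2]). *)
Lemma Fsum_split X : (forall i j, (j < m)%N || (m.+1 < j)%N -> X i j = 0) ->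
  exists2 S : zser 1 A, Fsum X = fadd HF (zmon (X 0%N m) m) S &
    val S (mon1 (P * q)) = X m.+1 m + X m m.+1 - u * binsum p q (X 0%N m.+1) (X 1%N m).
Proof.
move=> X0.
have idx1 (i j : nat) : (m <= j <= m.+1)%N -> ~~ ((i == 0%N) && (j == m)) ->
    ~~ ((i == 0%N) && (j == m.+1)) -> ~~ ((i == 1%N) && (j == m)) -> (m.+1 < i + j)%N.
  by clear; lia.
have idx2 (i j : nat) : ((i == m.+1) && (j == m) = false) ->
    ((i == m) && (j == m.+1) = false) -> (m.+1 + m = i + j)%N ->
    (j < m)%N || (m.+1 < j)%N.
  by clear; lia.
have [lt0 lt1 lt2 lt3] : [/\ (0 < N)%N, (1 < N)%N, (m < N)%N & (m.+1 < N)%N].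
  by split; lia.
pose k01 : 'I_N * 'I_N := (Ordinal lt0, Ordinal lt2).
pose k02 : 'I_N * 'I_N := (Ordinal lt0, Ordinal lt3).
pose k11 : 'I_N * 'I_N := (Ordinal lt1, Ordinal lt2).
have n02 : k02 != k01 by apply/eqP => -[/eqP]; rewrite gtn_eqF.
have n11 : k11 != k01 by rewrite xpair_eqE.
have n12 : k11 != k02 by rewrite xpair_eqE.
pose c (ij : 'I_N * 'I_N) := zmon (X ij.1 ij.2) (ij.1 + ij.2).
pose S := \big[fadd HF/zser0 1 A]_(ij | (ij != k01) && (ij != k02) && (ij != k11)) c ij.
exists (fadd HF (zmon (X 0%N m.+1) (0 + m.+1)) (fadd HF (zmon (X 1%N m) (1 + m)) S)).
  rewrite /Fsum (bigD1 k01) // (bigD1 k02) //.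
  by rewrite (bigD1 k11) //= n11 n12.
have q_gt1 : (1 < q)%N by rewrite -(expn0 p) ltn_exp2l.
have P_gt0 : (0 < P)%N by rewrite expn_gt0 p_gt0.
have PqE : (P * q = p ^ (m.+1 + m))%N by rewrite expnD.
have oT (ij : 'I_N * 'I_N) : (ij != k01) && (ij != k02) && (ij != k11) ->
    sord P.+1 (val (zmon (X ij.1 ij.2) (ij.1 + ij.2))).
  case: ij => i j /=; rewrite !xpair_eqE -!val_eqE /= => /andP[/andP[n1 n2] n3].
  have [/X0->|] := boolP ((j < m) || (m.+1 < j))%N; first by rewrite zmon0.
  rewrite negb_or -!leqNgt => /andP[le_mj le_jm].
  by apply: sord_zmon; rewrite ltn_exp2l //; apply: idx1; rewrite ?le_mj.
have oS : sord P.+1 (val S) by case: (fsum_lead HF (index_enum _) (ltn0Sn P) oT).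
have SP : val S (mon1 P) = 0 by rewrite oS ?mdeg_mon1.
have SPq : val S (mon1 (P * q)) = X m.+1 m + X m m.+1.
  rewrite /S scoef_fsum // PqE.
  rewrite (bigD1 (Ordinal lt3, Ordinal lt2)) /=; last first.
    by rewrite !xpair_eqE -!val_eqE /=; clear -m_gt0; lia.
  rewrite (bigD1 (Ordinal lt2, Ordinal lt3)) /=; last first.
    by rewrite !xpair_eqE -!val_eqE /=; clear -m_gt0; lia.
  rewrite !scoef_zmon eqxx [(m + _)%N]addnC eqxx !mulr1n addrA big1 ?addr0 //.
  case=> i j /=; rewrite !xpair_eqE -!val_eqE /= => /andP[/andP[_ /negPf n1] /negPf n2].
  by rewrite scoef_zmon; case: eqP => // Eij; rewrite X0 //; apply: idx2 Eij.
pose T := fadd HF (zmon (X 1%N m) (1 + m)) S.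
have o1 : sord P (val (zmon (X 1%N m) (1 + m))) by apply: sord_zmon.
have oS' : sord P (val S) := sord_le (leqnSn P) oS.
have [oT' dT] : sord P (val T) /\ sord P.+1 (val T - (val (zmon (X 1%N m) (1 + m)) + val S)).
  split; last exact: fadd_lead.
  by rewrite -(subrK (val (zmon (X 1%N m) (1 + m)) + val S) (val T)); apply: sordD;
    [apply: sord_le (leqnSn P) _; apply: fadd_lead | apply: sordD].
rewrite scoef_fadd //; last by apply: sord_zmon.
rewrite scoef_fadd // SP binsumx0 mulr0 subr0 SPq.
rewrite (sord_coef dT) ?mdeg_mon1 // scoefD SP addr0 PqE !scoef_zmon.
have -> : (m.+1 + m == 0 + m.+1)%N = false by clear -m_gt0; lia.
by rewrite !eqxx !mulr0n !mulr1n !add0r.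
Qed.

End CharP.

(** * Comparison of the two p-series *)

Lemma scomp1_0 (A : comNzRingType) (f : mseries 1 A) q :
  sord 1 f -> scomp1 f 0 = 0 :> mseries q A.
Proof.
move=> of_; apply: sord_eq => d; rewrite subr0.
apply: (@sord_le _ _ _ (d.+1 * 1)); first by rewrite muln1.
exact: sord_scompM.
Qed.

Lemma fgl_hom_fadd (A : comNzRingType) (F F' : mseries 2 A) (HF' : is_fgl F')
    (f : mseries 1 A) q (a b : zser q A) : fgl_hom F' F f ->
  scomp1 f (val (fadd HF' a b)) = scomp2 F (scomp1 f (val a)) (scomp1 f (val b)).
Proof.
case=> f0 fE; have of_ : sord 1 f by apply/sord1P/eqP.
pose g (i : 'I_2) := if i == ord0 then val a else val b.
have og i : sord 1 (g i) by apply: sord_if.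
have oF : sord 1 F' by apply/sord1P; rewrite (fgl_coef0 HF').
have o1 i : sord 1 (scomp1 f (svar i : mseries 2 A)) by apply: sord_scomp.
have := congr1 (fun s : mseries 2 A => scomp s g) fE.
rewrite scomp2_scomp // /scomp1 !scompA // => E.
rewrite [LHS](_ : _ = scomp f (fun=> scomp F' g)) // E.
by congr (scomp2 F _ _); apply: eq_scomp => i; rewrite scomp_svar.
Qed.

Lemma fgl_hom_fsum (A : comNzRingType) (F F' : mseries 2 A) (HF : is_fgl F)
    (HF' : is_fgl F') (f : mseries 1 A) q (I : Type) (r : seq I) (Q : pred I)
    (c : I -> zser q A) : fgl_hom F' F f ->
  scomp1 f (val (\big[fadd HF'/zser0 q A]_(i <- r | Q i) c i)) =
  val (\big[fadd HF/zser0 q A]_(i <- r | Q i) zs (scomp1 f (val (c i)))).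
Proof.
move=> f_hom; have of_ : sord 1 f by apply/sord1P/eqP; case: f_hom.
elim/big_rec2: _ => [|i x y _ IH]; first exact: scomp1_0.
rewrite (fgl_hom_fadd HF' _ _ f_hom) val_fadd val_zs ?IH //.
by apply: sord_scomp.
Qed.

Section Conclusion.
Context (p : nat) (pr_p : prime p) (G : mseries 2 (vring (zloc p))).
Hypothesis G_univ : universal_ptypical G.
Context (A : comNzRingType) (al be : {rmorphism vring (zloc p) -> A}).
Context (HF : is_fgl (smap al G)) (HF' : is_fgl (smap be G)).
Context (f : mseries 1 A) (f_hom : fgl_hom (smap be G) (smap al G) f).
Context (t : nat -> A) (D N : nat) (le_DN : (D <= p ^ N)%N).
Hypothesis t_sum :
  sord D (fgl_psum (smap al G) (fun i => sconst (t i) * sx ^+ (p ^ i)) N - f).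

Notation "\fsum_ ( i < n ) E" := (\big[fadd HF/zser0 _ A]_(i < n) E)
  (at level 36, E at level 36, i, n at level 50).

Lemma sord_monomialX q (c : A) (a : zser q A) j : sord 1 (sconst c * val a ^+ (p ^ j)).
Proof.
apply/sordMr/(@sord_le _ _ _ (1 * p ^ j)); last exact: sordX.
by rewrite mul1n expn_gt0 prime_gt0.
Qed.

Lemma zmonX (c d : A) i j :
  zs (sconst c * val (zmon p d i) ^+ (p ^ j)) = zmon p (c * d ^+ (p ^ j)) (i + j).
Proof.
rewrite (val_zmon pr_p) exprMn -exprM -expnD -rmorphXn mulrA -rmorphM.
by [].
Qed.

Lemma comp_fsum q (a : zser q A) :
  sord D (scomp1 f (val a) - val (\fsum_(i < N) zs (sconst (t i) * val a ^+ (p ^ i)))).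
Proof.
have oa (i : 'I_1) : sord 1 (val a) by apply: sord_zser.
have := sord_sym (sord_subscomp oa t_sum); rewrite (fgl_psumE HF); last first.
  by move=> i; have := sord_monomialX (t i) (zs sx) i; rewrite val_zs //; apply: sord_svar.
rewrite scomp_fsum //.
suff E j : scomp (val (zs (sconst (t j) * sx ^+ (p ^ j)))) (fun _ : 'I_1 => val a) =
    sconst (t j) * val a ^+ (p ^ j).
  by under eq_bigr do rewrite E.
have := sord_monomialX (t j) (zs sx) j; rewrite val_zs; last exact: sord_svar.
by move/val_zs->; rewrite scompM // scomp_sconst // scompX // scomp_svar.
Qed.

(** Both sides expand f([p](x)), with [p] taken for the source law. For the left one, [p](x) is
    expanded by the Araki formula and f is applied to each term. For the right one, f is moved
    inside the p-fold sum, and the Araki formula for the target law is applied to each t_i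
    x^(p^i). *)
Lemma pseries_compare :
  sord D (val (Fsum p HF N (fun i j => t i * be (araki p j) ^+ (p ^ i))) -
          val (Fsum p HF N (fun i j => al (araki p j) * t i ^+ (p ^ j)))).
Proof.
have of_ : sord 1 f by apply/sord1P/eqP; case: f_hom.
pose x : zser 1 A := zs sx.
have xE k c : zs (sconst c * val x ^+ (p ^ k)) = zmon p c k.
  by rewrite val_zs //; apply: sord_svar.
have o1 (a : zser 1 A) : sord 1 (scomp1 f (val a)) by apply: sord_scomp.
pose W := scomp1 f (val (\big[fadd HF'/zser0 1 A]_(k < p) x)).
apply: (@sord_trans _ _ _ _ W).
  apply/sord_sym.
  have step := sord_le le_DN (@ptypical_pseries p pr_p G G_univ A be HF' N 1 x).
  have {}step : sord D (W - scomp1 f (val (\big[fadd HF'/zser0 1 A]_(j < N)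
      zs (sconst (be (araki p j)) * val x ^+ (p ^ j))))).
    exact: (@sord_subscompr 1 1 A _ (fun _ => sord_zser _)).
  apply: sord_trans step _; rewrite (fgl_hom_fsum HF HF' _ _ _ f_hom) /Fsum.
  rewrite -(pair_bigA _ (fun i j : 'I_N => zmon p (t i * be (araki p j) ^+ (p ^ i)) (i + j))) /=.
  rewrite exchange_big; apply: fsum_congr => j _.
  rewrite xE val_zs; last exact: o1.
  apply: sord_trans (comp_fsum _) _; apply: fsum_congr => i _.
  by rewrite zmonX addnC.
rewrite /W (fgl_hom_fsum HF HF' _ _ _ f_hom).
have step1 := comp_fsum x.
apply: (@sord_trans _ _ _ _ (val (\big[fadd HF/zser0 1 A]_(k < p) \fsum_(i < N) zmon p (t i) i))).
  apply: fsum_congr => k _; rewrite val_zs; last exact: o1.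
  by under [\big[_/_]_(i < N) zmon _ _ _]eq_bigr do rewrite -xE.
rewrite exchange_big /Fsum.
rewrite -(pair_bigA _ (fun i j : 'I_N => zmon p (al (araki p j) * t i ^+ (p ^ j)) (i + j))) /=.
apply: fsum_congr => i _.
have := sord_le le_DN (@ptypical_pseries p pr_p G G_univ A al HF N 1 (zmon p (t i) i)).
by under [\big[_/_]_(j < N) zs _]eq_bigr do rewrite zmonX.
Qed.

End Conclusion.

(** In one variable there is one monomial per degree, so coefficientwise convergence is uniform
    below each degree. *)
Lemma is_fgl_sum_sord (A : comNzRingType) (F : mseries 2 A) c s d :
  is_fgl_sum F c s -> exists N, forall n, (N <= n)%N -> sord d (fgl_psum F c n - s).
Proof.
move=> cs; elim: d => [|d [N1 IHd]]; first by exists 0%N.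
have [N2 E] := cs (mon1 d); exists (maxn N1 N2) => n; rewrite geq_max => /andP[le1 le2].
apply: sord_mon1 => k; rewrite ltnS leq_eqVlt => /predU1P[->|lt_kd].
  by rewrite scoefB E // subrr.
by apply: (IHd n le1); rewrite mdeg_mon1.
Qed.

(** * Comparison of coefficients in a ring where u^(q+1) = 0 *)

Section Comparison.
Context (p : nat) (pr_p : prime p) (G : mseries 2 (vring (zloc p))).
Hypothesis G_univ : universal_ptypical G.
Context (A : comNzRingType) (p0 : p%:R = 0 :> A).
Context (al be : {rmorphism vring (zloc p) -> A}).
Context (m : nat) (m_gt0 : (0 < m)%N).
Let u := al (araki p m).
Let q := (p ^ m)%N.
Let P := (p ^ m.+1)%N.
Hypothesis al_low : forall i, (i < m)%N -> al (araki p i) = 0.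
Hypothesis al_high : forall i, (m.+1 < i)%N -> al (araki p i) = 0.
Hypothesis al1 : al (araki p m.+1) = 1.
Hypothesis be_high : forall i, (m.+1 < i)%N -> be (araki p i) = 0.
Hypothesis be1 : be (araki p m.+1) = 1.
Hypothesis u_nil : u ^+ q.+1 = 0.
Context (f : mseries 1 A) (f_hom : fgl_hom (smap be G) (smap al G) f).
Context (t : nat -> A).
Hypothesis f_sum : is_fgl_sum (smap al G) (fun i => sconst (t i) * sx ^+ (p ^ i)) f.
Context (f1' : A) (f1K : f (mon1 1) * f1' = 1).

Let p_gt0 : (0 < p)%N := prime_gt0 pr_p.
Let p_gt1 : (1 < p)%N := prime_gt1 pr_p.
Let HG : is_fgl G. Proof. by case: G_univ. Qed.
Let HF : is_fgl (smap al G). Proof. exact: smap_fgl. Qed.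
Let HF' : is_fgl (smap be G). Proof. exact: smap_fgl. Qed.

Let b := be (araki p m).
Let XL i j := t i * be (araki p j) ^+ (p ^ i).
Let XR i j := al (araki p j) * t i ^+ (p ^ j).

Lemma compare_at : exists N, [/\ (m.*2.+1 < N)%N, t 0%N = f (mon1 1) &
  sord (P * q).+1 (val (Fsum p HF N XL) - val (Fsum p HF N XR))].
Proof.
have [N0 oN] := is_fgl_sum_sord (P * q).+1 f_sum.
(* The partial formal sum must represent f through degree Pq, and p^N must exceed Pq = p^(2m+1). *)
pose N := maxn N0 m.*2.+2; exists N.
have lt_N : (m.*2.+1 < N)%N by rewrite leq_maxr.
have oN' := oN N (leq_maxl _ _).
have N_gt0 : (0 < N)%N by apply: leq_trans lt_N.
split=> //; last first.
  apply: (pseries_compare pr_p G_univ HF HF' f_hom _ oN').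
  by rewrite /P /q -expnD ltn_exp2l // addSn addnn.
have Pq_gt0 : (0 < P * q)%N by rewrite muln_gt0 !expn_gt0 p_gt0.
rewrite -(sord_coef oN') ?mdeg_mon1 //.
have oc i : sord 1 (sconst (t i) * sx ^+ (p ^ i) : mseries 1 A).
  by have := sord_monomialX pr_p (t i) (zs sx) i; rewrite val_zs //; apply: sord_svar.
rewrite (fgl_psumE HF) //.
have [_ oE] := @fsum_lead A _ HF 1 1 _ (index_enum 'I_N) predT
  (fun i : 'I_N => zs (sconst (t i) * sx ^+ (p ^ i))) isT (fun i _ => sord_zser _).
rewrite (sord_coef oE) ?mdeg_mon1 // scoef_sum (bigD1 (Ordinal N_gt0)) //=.
rewrite val_zs // big1 ?addr0.
  by rewrite scoef_monomial expn0 eqxx.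
move=> i; rewrite -val_eqE /= -lt0n => i_gt0; rewrite val_zs // scoef_monomial ltn_eqF //.
by apply: leq_trans p_gt1 _; rewrite -{1}[p]expn1 leq_exp2l.
Qed.

Let t0K : t 0%N * f1' = 1. Proof. by have [N [_ -> _]] := compare_at. Qed.

(** Induction on j: t_0 is invertible, so the earlier cases force the images under [be] of the lower
    generators to vanish. Degree p^j is then the lowest possible on both sides, and only the pair
    (0, j) contributes to it. *)
Let low j : (j <= m)%N -> t 0%N * be (araki p j) = al (araki p j) * t 0%N ^+ (p ^ j).
Proof.
have [N [lt_N _ E]] := compare_at.
elim/ltn_ind: j => j IHj le_jm.
have be0 i : (i < j)%N -> be (araki p i) = 0.
  move=> lt_ij; have := IHj i lt_ij (leq_trans (ltnW lt_ij) le_jm).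
  rewrite al_low ?(leq_trans lt_ij) // mul0r => /(congr1 (fun x => f1' * x)).
  by rewrite mulrA [f1' * _]mulrC t0K mul1r mulr0.
have lt_jN : (j < N)%N.
  by apply: leq_ltn_trans le_jm (leq_ltn_trans _ lt_N); rewrite -addnn -addnS leq_addr.
have lt_j : (p ^ j < (P * q).+1)%N.
  by rewrite ltnS /P /q -expnD leq_exp2l // (leq_trans le_jm) // leq_addl.
have := @sord_coef _ _ _ _ _ (mon1 (p ^ j)) E; rewrite mdeg_mon1 => /(_ lt_j).
rewrite !(scoef_Fsum pr_p) //.
- by move=> i k lt_kj; rewrite /XR al_low ?mul0r // (leq_trans lt_kj).
- move=> i k lt_kj; rewrite /XL be0 // expr0n expn_eq0.
  by rewrite gtn_eqF ?mulr0.
Qed.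

Let bE : b = u * (f1' * t 0%N ^+ q).
Proof.
have := low (leqnn m) => /(congr1 (fun x => f1' * x)).
by rewrite mulrA [f1' * _]mulrC t0K mul1r => E; rewrite /b E mulrCA.
Qed.

Let be_low i : (i < m)%N -> be (araki p i) = 0.
Proof.
move=> lt_im; have := low (ltnW lt_im); rewrite al_low // mul0r.
by move/(congr1 (fun x => f1' * x)); rewrite mulrA [f1' * _]mulrC t0K mul1r mulr0.
Qed.

Let u_nilX k : (q < k)%N -> u ^+ k = 0.
Proof. by move=> lt_qk; rewrite -(subnK lt_qk) exprD u_nil mulr0. Qed.

(** By [low] the terms of degree q on the two sides are equal, so they cancel in the formal group;
    [Fsum_split] then gives the coefficient of x^(Pq) on each side. *)
Let top_coef :
  t m.+1 * b ^+ P + t m - u * binsum p q (t 0%N) (t 1%N * b ^+ p) =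
  u * t m.+1 ^+ q + t m ^+ P - u * binsum p q (t 0%N ^+ P) (u * t 1%N ^+ q).
Proof.
have [N [lt_N _ E]] := compare_at.
have lead : sord q.+1 (smap al G - (sx2 + sy2) + sconst u * binsum p q sx2 sy2).
  by apply: ptypical_lead => // i /andP[_ lt_im]; apply: al_low.
have XL0 i j : (j < m)%N || (m.+1 < j)%N -> XL i j = 0.
  have pi : (p ^ i == 0)%N = false by rewrite expn_eq0 gtn_eqF.
  by case/orP=> [/be_low|/be_high] E0; rewrite /XL E0 expr0n pi mulr0.
have XR0 i j : (j < m)%N || (m.+1 < j)%N -> XR i j = 0.
  by case/orP=> [/al_low|/al_high] E0; rewrite /XR E0 mul0r.
have [SL EL cL] := Fsum_split pr_p HF m_gt0 lead lt_N XL0.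
have [SR ER cR] := Fsum_split pr_p HF m_gt0 lead lt_N XR0.
have X0E : XL 0%N m = XR 0%N m by rewrite /XL expn0 expr1 low.
move: E; rewrite EL ER X0E => /fadd_cancel/(@sord_coef _ _ _ _ _ (mon1 (P * q))).
rewrite mdeg_mon1 => /(_ (ltnSn _)); rewrite cL cR /XL /XR al1 be1.
by rewrite !expr1n !mulr1 !mul1r expn1.
Qed.

Lemma compare_coefficients :
  t m = t m ^+ (p ^ m.+1) + u * t m.+1 ^+ (p ^ m) -
    \sum_(1 <= j < p) ('C(p, j) %/ p)%:R * u ^+ (j * p ^ m.-1 + 1) *
      t 1%N ^+ (j * p ^ (m.*2.-1)) * t 0%N ^+ (p ^ m.*2 * (p - j)).
Proof.
have qE : q = (p ^ m.-1.+1)%N by rewrite prednK.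
have lt_qP : (q < P)%N by rewrite ltn_exp2l.
have bP : b ^+ P = 0 by rewrite bE exprMn u_nilX ?mul0r.
pose r := (p ^ m.-1)%N; have prE : (r * p = q)%N by rewrite qE expnSr.
have frob (x y : A) : binsum p q x y = binsum p p (x ^+ r) (y ^+ r).
  by rewrite qE binsum_pchar.
(* After the reduction to [binsum p p], each summand contains u b^(qi) with i > 0, a multiple of
   u^(1+qi), hence of u^(q+1) = 0. *)
have L0 : u * binsum p q (t 0%N) (t 1%N * b ^+ p) = 0.
  rewrite frob /binsum mulr_sumr big_nat big1 // => i /andP[i_gt0 _].
  have uB : u * b ^+ p ^+ r ^+ i = 0.
    have -> : b ^+ p ^+ r ^+ i = b ^+ (q * i) by rewrite -prE [(r * p)%N]mulnC 2!exprM.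
    rewrite bE exprMn mulrA -exprS.
    by rewrite u_nilX ?mul0r // ltnS leq_pmulr.
  by rewrite 2!exprMn mulrCA [u * (_ * _)]mulrCA uB !mulr0.
move: top_coef; rewrite bP mulr0 add0r L0 subr0 => E; rewrite {1}E.
rewrite [u * _ + _]addrC; congr (_ - _).
have qrE : (q * r = p ^ m.*2.-1)%N.
  by rewrite -expnD; congr (p ^ _)%N; clear -m_gt0; lia.
have PrE : (P * r = p ^ m.*2)%N.
  by rewrite -expnD; congr (p ^ _)%N; clear -m_gt0; lia.
rewrite frob /binsum mulr_sumr; apply: eq_bigr => j _.
have -> : t 0%N ^+ P ^+ r ^+ (p - j) = t 0%N ^+ (p ^ m.*2 * (p - j)).
  by rewrite -PrE 2!exprM.
have -> : (u * t 1%N ^+ q) ^+ r ^+ j = u ^+ (j * r) * t 1%N ^+ (j * p ^ m.*2.-1).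
  by rewrite 2!exprMn -qrE [(j * r)%N]mulnC [(j * _)%N]mulnC !exprM.
rewrite addn1 exprS.
move: (u ^+ _) (t 1%N ^+ _) (t 0%N ^+ _) => x y z; ring.
Qed.

End Comparison.

(** * The Lubin-Tate ring *)

Section IdealQuotient.
Context (R : comNzRingType) (I : finType) (s : I -> R).

Lemma in_ideal_gen i : in_ideal s (s i).
Proof.
exists (fun j => (j == i)%:R); rewrite (bigD1 i) //= eqxx mul1r.
by rewrite big1 ?addr0 // => j /negPf ->; rewrite mul0r.
Qed.

Lemma in_ideal_closed a x y : in_ideal s x -> in_ideal s y -> in_ideal s (a * x + y).
Proof.
case=> c -> [d ->]; exists (fun i => a * c i + d i).
by rewrite mulr_sumr -big_split; apply: eq_bigr => i _; rewrite mulrDl mulrA.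
Qed.

Lemma in_ideal0 : in_ideal s 0.
Proof. by exists (fun=> 0); rewrite big1 // => i _; rewrite mul0r. Qed.

Lemma in_ideal_total x : in_ideal s 1 -> in_ideal s x.
Proof.
by move=> i1; rewrite -[x]mulr1 -[x * 1]addr0; apply: in_ideal_closed in_ideal0.
Qed.

Hypothesis proper : ~ in_ideal s 1.

Definition ideal_pred : {pred R} := fun x => `[< in_ideal s x >].

Lemma ideal_pred_closed : idealr_closed ideal_pred.
Proof.
split=> [||a x y]; first exact/asboolP/in_ideal0.
  by apply/negP => /asboolP.
by move=> /asboolP ix /asboolP iy; apply/asboolP/in_ideal_closed.
Qed.

HB.instance Definition _ := isIdealr.Build R ideal_pred ideal_pred_closed.

Lemma ideal_quotient : exists (A : comNzRingType) (pi : {rmorphism R -> A}),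
  forall x, pi x = 0 <-> in_ideal s x.
Proof.
exists {ideal_quot ideal_pred}, \pi_({ideal_quot ideal_pred})%qT => x.
split=> [/eqP|ix].
  rewrite -(rmorph0 \pi_({ideal_quot ideal_pred})%qT) -Quotient.idealrBE subr0.
  by move/asboolP.
apply/eqP; rewrite -(rmorph0 \pi_({ideal_quot ideal_pred})%qT) -Quotient.idealrBE subr0.
exact/asboolP.
Qed.

End IdealQuotient.

Lemma scomp1_coef1 (R : comNzRingType) (f a : mseries 1 R) :
  sord 1 f -> sord 1 a -> (scomp1 f a) (mon1 1) = f (mon1 1) * a (mon1 1).
Proof.
move=> of_ oa; have := @sord_scomp_diff 1 1 R (fun _ => a) (fun _ => oa) 1 f
  (fun _ => 0) (fun _ => @sord0 _ _ _) isT.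
rewrite -/(scomp1 f 0) scomp1_0 // big_ord1 !subr0 => /(_ (fun _ => oa)) E.
by rewrite (sord_coef E) ?mdeg_mon1 // sconst_mulE.
Qed.

Lemma scomp1_unit (R : comNzRingType) (f a : mseries 1 R) :
  sord 1 f -> sord 1 a -> scomp1 f a = sx -> f (mon1 1) * a (mon1 1) = 1.
Proof. by move=> of_ oa fa; rewrite -scomp1_coef1 // fa scoef_sx. Qed.

(* Conjugating the target of psi by the inverse of g and composing psi with g *)
(* cancel out; this is the homomorphism property of h_g.                      *)
Lemma conj_fgl_hom (R : comNzRingType) (F F1 : mseries 2 R) (g g' psi : mseries 1 R) :
    is_fgl F -> is_fgl F1 -> g 0%MM = 0 -> g' 0%MM = 0 -> scomp1 g g' = sx ->
  fgl_hom F1 (scomp1 g' (scomp2 F (scomp1 g sx2) (scomp1 g sy2))) psi ->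
  fgl_hom F1 F (scomp1 g psi).
Proof.
move=> HF HF1 /eqP/sord1P og /eqP/sord1P og' gg' [psi0 psiE].
have opsi : sord 1 psi by apply/sord1P/eqP.
have oF1 : sord 1 F1 by apply/sord1P; rewrite (fgl_coef0 HF1).
have o1 n q (f : mseries n R) (a : 'I_n -> mseries q R) :
    sord 1 f -> (forall i, sord 1 (a i)) -> sord 1 (scomp f a).
  by move=> of_ oa; apply: sord_scomp.
split; first by apply/eqP/sord1P/o1.
rewrite /scomp1 scompA // -/(scomp1 psi F1) psiE.
pose a (i : 'I_2) := if i == ord0 then scomp1 psi sx2 else scomp1 psi sy2.
have oa i : sord 1 (a i) by apply: sord_if; apply: o1.
have ogi (i : 'I_2) : sord 1 (scomp1 g (svar i : mseries 2 R)) by apply: o1.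
have oZ : sord 1 (scomp2 F (scomp1 g sx2) (scomp1 g sy2)).
  by apply: sord_scomp2; rewrite ?(fgl_coef0 HF).
rewrite [X in scomp g (fun=> X)](_ : _ = scomp1 g' (scomp2 F (scomp1 (scomp1 g psi) sx2)
  (scomp1 (scomp1 g psi) sy2))); last first.
  rewrite /scomp2 -/a /scomp1 scompA //; apply: eq_scomp => _.
  rewrite -[LHS]/(scomp (scomp2 F (scomp1 g sx2) (scomp1 g sy2)) a) scomp2_scomp //.
  rewrite /scomp1 !scompA //.
  by congr (scomp2 F _ _); apply: eq_scomp => i; rewrite scomp_svar.
set Z := scomp2 F _ _.
have oZ' : sord 1 Z.
  by apply: sord_scomp2; rewrite ?(fgl_coef0 HF) //; apply/o1 => // i; apply/o1.
by rewrite /scomp1 -scompA // -/(scomp1 g g') gg' scomp_svar.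
Qed.

Section SmapTransport.
Context (R B : comNzRingType) (f : {rmorphism R -> B}).

Lemma smap_fgl_hom (F F' : mseries 2 R) (s : mseries 1 R) :
  fgl_hom F F' s -> fgl_hom (smap f F) (smap f F') (smap f s).
Proof.
case=> s0 sE; split; first by rewrite /= s0 rmorph0.
have := congr1 (smap f) sE.
by rewrite smap_scomp2 !smap_scomp1 !smap_svar.
Qed.

Lemma smap_psum (F : mseries 2 R) (c : nat -> mseries 1 R) n :
  smap f (fgl_psum F c n) = fgl_psum (smap f F) (fun i => smap f (c i)) n.
Proof.
elim: n => [|n IHn]; first exact: (rmorph0 (smap f)).
by rewrite /= smap_scomp2 IHn.
Qed.

Lemma smap_fgl_sum (F : mseries 2 R) (c : nat -> mseries 1 R) s :
  is_fgl_sum F c s -> is_fgl_sum (smap f F) (fun i => smap f (c i)) (smap f s).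
Proof.
move=> cs m; have [N E] := cs m; exists N => n le_Nn.
by rewrite -smap_psum /= E.
Qed.

End SmapTransport.

Section LubinTateParameters.
Context (p : nat) (pr_p : prime p) (m : nat) (k : finFieldType).
Notation R := (ltring pr_p m.+1 k).

Lemma lt_u_top : lt_u pr_p m.+1 k m.+1 = 1.
Proof. by rewrite /lt_u insubF ?eqxx //= ltnn. Qed.

Lemma lt_u_high i : (m.+1 < i)%N -> lt_u pr_p m.+1 k i = 0.
Proof.
case: i => // i lt_mi; rewrite /lt_u insubF /=; last by rewrite ltnNge ltnW.
by rewrite gtn_eqF.
Qed.

Lemma lt_modulus_low i : (i < m)%N ->
  in_ideal (@lt_modulus p pr_p m.+1 k) (lt_u pr_p m.+1 k i).
Proof.
move=> lt_im; have lt_i : (i < m.+1)%N by apply: ltnW.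
have := in_ideal_gen (@lt_modulus p pr_p m.+1 k) (Ordinal lt_i).
by rewrite /lt_modulus /= ltn_eqF.
Qed.

Lemma lt_modulus_top :
  in_ideal (@lt_modulus p pr_p m.+1 k) (lt_u pr_p m.+1 k m ^+ (p ^ m).+1).
Proof.
have := in_ideal_gen (@lt_modulus p pr_p m.+1 k) ord_max.
by rewrite /lt_modulus /= eqxx addn1.
Qed.

End LubinTateParameters.

(** The exponents are arbitrary, so passing from an equality in A to membership in the kernel of f
    involves no arithmetic on them. *)
Lemma rmorph_defect (R A : comNzRingType) (f : {rmorphism R -> A}) p (t : nat -> R)
    (m a b : nat) (u : R) (c d e : nat -> nat) :
  f (t m) = f (t m) ^+ a + f u * f (t m.+1) ^+ b -
    \sum_(1 <= j < p) ('C(p, j) %/ p)%:R * f u ^+ c j * f (t 1%N) ^+ d j * f (t 0%N) ^+ e j ->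
  f (t m - (t m ^+ a + u * t m.+1 ^+ b -
    \sum_(1 <= j < p) ('C(p, j) %/ p)%:R * u ^+ c j * t 1%N ^+ d j * t 0%N ^+ e j)) = 0.
Proof.
move=> E; apply/eqP; rewrite rmorphB subr_eq0 {1}E rmorphB rmorphD rmorphM !rmorphXn.
rewrite rmorph_sum; apply/eqP; congr (_ - _); apply: eq_bigr => j _.
by rewrite !rmorphM rmorph_nat !rmorphXn.
Qed.

Theorem theorem4p16 (p : nat) (pr_p : prime p) (h : nat) (h_ge2 : (2 <= h)%N)
    (k : finFieldType) (card_k : #|k| = (p ^ h)%N)
    (G : mseries 2 (vpoly (zloc p))) (G_univ : universal_ptypical G)
    (phi : {rmorphism vpoly (zloc p) -> ltring pr_p h k})
    (phi_v : forall i, phi (araki_v (zloc p) p i) = lt_u pr_p h k i)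
    (H : mseries 2 'F_p) (H_honda : honda G h H)
    (g : mseries 1 k)
    (g_aut : fgl_iso (smap (Fp_base k) H) (smap (Fp_base k) H) g)
    (t : nat -> ltring pr_p h k) (t_g : deform_coords (smap phi G) g t) :
  let u := lt_u pr_p h k h.-1 in
  in_ideal (@lt_modulus p pr_p h k)
    (t h.-1 -
     (t h.-1 ^+ (p ^ h) + u * t h ^+ (p ^ h.-1) -
      \sum_(1 <= j < p)
        ('C(p, j) %/ p)%:R * u ^+ (j * p ^ (h - 2) + 1) *
        t 1%N ^+ (j * p ^ (2 * h - 3)) *
        t 0%N ^+ (p ^ (2 * h - 2) * (p - j)))).
Proof.
clear H H_honda g_aut card_k.
case: h h_ge2 phi phi_v t t_g => // m m_gt0 phi phi_v t t_g u.
pose J := @lt_modulus p pr_p m.+1 k.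
(* If 1 lies in the ideal, membership is automatic. Otherwise the quotient is a nonzero ring A,
   where the congruence becomes an equality. *)
have [in1|/ideal_quotient[A [pi piE]]] := pselect (in_ideal J 1).
  exact: in_ideal_total.
apply/piE.
pose V : comNzRingType := vring (zloc p).
pose phi' : {rmorphism V -> ltring pr_p m.+1 k} := phi.
have [gW [gWinv [gamma [psi [lift_g inv_g gamma_cont psi_iso psi_sum]]]]] := t_g.
pose al : {rmorphism V -> A} := pi \o phi'.
pose be : {rmorphism V -> A} := pi \o (gamma \o phi').
pose gh := smap sconst gW : mseries 1 (ltring pr_p m.+1 k).
pose ghinv := smap sconst gWinv : mseries 1 (ltring pr_p m.+1 k).
have HG : is_fgl (G : mseries 2 V) by case: G_univ.
have HF : is_fgl (smap phi' G) := smap_fgl phi' HG.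
have HF1 : is_fgl (smap gamma (smap phi' G)) := smap_fgl gamma HF.
have [[psi_hom [psi' [psi'0 psiK _]]] _] := psi_iso.
have [gW0 _] := lift_g; have [gWinv0 gWK _] := inv_g.
pose c0 : {rmorphism witt pr_p k -> ltring pr_p m.+1 k} := @sconst m (witt pr_p k).
have ghK : scomp1 gh ghinv = sx.
  have := smap_scomp1 c0 gW gWinv; rewrite gWK smap_svar => E.
  exact: esym E.
have gh0 : gh 0%MM = 0 := etrans (congr1 c0 gW0) (rmorph0 c0).
have ghinv0 : ghinv 0%MM = 0 := etrans (congr1 c0 gWinv0) (rmorph0 c0).
have f_hom := conj_fgl_hom HF HF1 gh0 ghinv0 ghK psi_hom.
(* This is [h_g], the star-isomorphism [psi] followed by the lift of g. *)
pose S : mseries 1 (ltring pr_p m.+1 k) := scomp1 gh psi.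
have fA_hom : fgl_hom (smap be G) (smap al G) (smap pi S) := smap_fgl_hom pi f_hom.
have S_sum : is_fgl_sum (smap phi' G) (fun i => sconst (t i) * sx ^+ (p ^ i)) S := psi_sum.
have fA_sum : is_fgl_sum (smap al G) (fun i => sconst (pi (t i)) * sx ^+ (p ^ i)) (smap pi S).
  suff <- : (fun i => smap pi (sconst (t i) * sx ^+ (p ^ i))) =
      (fun i => sconst (pi (t i)) * sx ^+ (p ^ i)) by exact: (smap_fgl_sum pi S_sum).
  by apply: funext => i; rewrite smapM smapX smap_sconst smap_svar.
have ogh : sord 1 gh by apply/sord1P/eqP.
have oghinv : sord 1 ghinv by apply/sord1P/eqP.
have opsi : sord 1 psi by apply/sord1P/eqP; case: psi_hom.
have opsi' : sord 1 psi' by apply/sord1P/eqP.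
have gh1 : gh (mon1 1) * ghinv (mon1 1) = 1 := scomp1_unit ogh oghinv ghK.
have psi1 : psi (mon1 1) * psi' (mon1 1) = 1 := scomp1_unit opsi opsi' psiK.
(* The linear coefficient of [h_g] is the product of those of the lift and of [psi]; its inverse is
   the product of the linear coefficients of their inverse series. *)
have f1K : smap pi S (mon1 1) * pi (ghinv (mon1 1) * psi' (mon1 1)) = 1.
  rewrite -[smap pi S (mon1 1)]/(pi (S (mon1 1))) -rmorphM /S scomp1_coef1 //.
  by rewrite mulrACA gh1 psi1 mulr1 rmorph1.
have phiE i : phi' (araki p i) = lt_u pr_p m.+1 k i by exact: phi_v.
have alE i : al (araki p i) = pi (lt_u pr_p m.+1 k i) := congr1 pi (phiE i).
have beE i : be (araki p i) = pi (gamma (lt_u pr_p m.+1 k i)) :=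
  congr1 (fun x => pi (gamma x)) (phiE i).
have al_low i : (i < m)%N -> al (araki p i) = 0.
  by move=> lt_im; rewrite alE; apply/piE/lt_modulus_low.
have p0 : p%:R = 0 :> A.
  by have := al_low 0%N m_gt0; rewrite alE /= rmorph_nat.
have al_high i : (m.+1 < i)%N -> al (araki p i) = 0.
  by move=> lt_mi; rewrite alE lt_u_high // rmorph0.
have al1 : al (araki p m.+1) = 1 by rewrite alE lt_u_top rmorph1.
have be_high i : (m.+1 < i)%N -> be (araki p i) = 0.
  by move=> lt_mi; rewrite beE lt_u_high // !rmorph0.
have be1 : be (araki p m.+1) = 1 by rewrite beE lt_u_top !rmorph1.
have u_nil : al (araki p m) ^+ (p ^ m).+1 = 0.
  by rewrite alE -rmorphXn; apply/piE/lt_modulus_top.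
have := @compare_coefficients p pr_p G G_univ A p0 al be m m_gt0 al_low al_high al1
  be_high be1 u_nil _ fA_hom _ fA_sum _ f1K.
rewrite alE => key; apply: rmorph_defect.
have -> : (m.+1 - 2)%N = m.-1 by clear; lia.
have -> : (2 * m.+1 - 3)%N = m.*2.-1 by clear; lia.
have -> : (2 * m.+1 - 2)%N = m.*2 by clear; lia.
exact: key.
Qed.
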